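(* Let $R$ be a ring with $\mathrm{Ggldim}\,R<\infty$. (a) If $R$ is right coherent, then $\mathsf{GPac}\text{-}\mathrm{gldim}\,R<\infty$. (b) If $R$ is left coherent, then $\mathsf{GIac}\text{-}\mathrm{gldim}\,R<\infty$.
   Context: All rings are associative; an $R$-module is a left $R$-module, and right $R$-modules are modules over the opposite ring $R^\circ$. A module $F$ is of type $\mathrm{FP}_\infty$ if it has a projective resolution by finitely generated projective modules. A left $R$-module $A$ is absolutely clean if $\mathrm{Ext}^1_R(F,A)=0$ for all left $R$-modules $F$ of type $\mathrm{FP}_\infty$. A left $R$-module $L$ is level if $\mathrm{Tor}_1^R(F,L)=0$ for all right $R$-modules $F$ of type $\mathrm{FP}_\infty$. An $R$-module $M$ is Gorenstein AC-projective (resp. Gorenstein projective) if there is an exact sequence $\cdots\to P_1\to P_0\to P_{-1}\to\cdots$ of projective $R$-modules with $M\cong\mathrm{Coker}(P_1\to P_0)$ that remains exact after applying $\mathrm{Hom}_R(-,L)$ for each level (resp. projective) $R$-module $L$. $M$ is Gorenstein AC-injective if there is an exact sequence $\cdots\to I_1\to I_0\to I_{-1}\to\cdots$ of injective $R$-modules with $M\cong\mathrm{Coker}(I_1\to I_0)$ that remains exact after applying $\mathrm{Hom}_R(A,-)$ for each absolutely clean $R$-module $A$. The Gorenstein projective dimension $\mathrm{Gpd}_RM$ (resp. Gorenstein AC-projective dimension) is $\le n$ iff there is an exact sequence $0\to G_n\to\cdots\to G_0\to M\to0$ with each $G_i$ Gorenstein projective (resp. Gorenstein AC-projective). The Gorenstein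 AC-injective dimension is $\le n$ iff there is an exact sequence $0\to M\to G^0\to\cdots\to G^n\to0$ with each $G^i$ Gorenstein AC-injective. $\mathrm{Ggldim}\,R$, $\mathsf{GPac}\text{-}\mathrm{gldim}\,R$, $\mathsf{GIac}\text{-}\mathrm{gldim}\,R$ denote the suprema over all $R$-modules of the Gorenstein projective, Gorenstein AC-projective, and Gorenstein AC-injective dimensions, respectively. *)

(* Defs.v *)
From HB Require Import structures.
From mathcomp Require Import all_boot all_algebra.
From mathcomp Require Import boolp.
From mathcomp.multinomials Require Import freeg.

Set Implicit Arguments.
Unset Strict Implicit.
Unset Printing Implicit Defensive.

Import GRing.Theory.
Local Open Scope ring_scope.
Local Open Scope quotient_scope.

(* Rings are associative and unital; [pzRingType] includes the zero ring.     *)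
(* A left R-module is an [lmodType R]; a right R-module is an [lmodType R^c], *)
(* where [R^c] is the opposite ring, so that [r *: p] with [r : R^c] is p.r.  *)

Definition surj (U V : Type) (f : U -> V) : Prop :=
  forall y, exists x, f x = y.

Definition exact_at (U V W : zmodType) (f : U -> V) (g : V -> W) : Prop :=
  forall y, g y = 0 <-> exists x, f x = y.

Section FinitenessConditions.
Variable R : pzRingType.
Implicit Types M P I : lmodType R.

Definition projective P : Prop :=
  forall (A B : lmodType R) (f : {linear A -> B}) (g : {linear P -> B}),
    surj f -> exists h : {linear P -> A}, f \o h =1 g.

Definition injective_module I : Prop :=
  forall (A B : lmodType R) (f : {linear A -> B}) (g : {linear A -> I}),
    injective f -> exists h : {linear B -> I}, h \o f =1 g.

Definition fin_gen M : Prop :=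
  exists (n : nat) (g : 'I_n -> M),
    forall m : M, exists c : 'I_n -> R, m = \sum_(i < n) c i *: g i.

Definition fin_pres M : Prop :=
  exists (m n : nat) (f : {linear 'rV[R]_m -> 'rV[R]_n})
         (g : {linear 'rV[R]_n -> M}),
    exact_at f g /\ surj g.

(* A left ideal of R is, up to isomorphism, a submodule I of R^o. *)
Definition left_coherent : Prop :=
  forall (I : lmodType R) (i : {linear I -> R^o}),
    injective i -> fin_gen I -> fin_pres I.

(* ... -> P 1 -> P 0 -> M -> 0 *)
Definition resolution M (P : nat -> lmodType R)
    (d : forall i, {linear P i.+1 -> P i}) (e : {linear P 0%N -> M}) : Prop :=
  [/\ forall i, exact_at (d i.+1) (d i), exact_at (d 0%N) e & surj e].

Definition projective_resolution M (P : nat -> lmodType R)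
    (d : forall i, {linear P i.+1 -> P i}) (e : {linear P 0%N -> M}) : Prop :=
  resolution d e /\ forall i, projective (P i).

Definition FP_infty M : Prop :=
  exists (P : nat -> lmodType R) (d : forall i, {linear P i.+1 -> P i})
         (e : {linear P 0%N -> M}),
    projective_resolution d e /\ forall i, fin_gen (P i).

End FinitenessConditions.

Definition right_coherent (R : pzRingType) : Prop := left_coherent R^c.

Section Tensor.
Variables (R : pzRingType) (P : lmodType R^c) (L : lmodType R).

Local Notation free := {freeg (P * L)%type}.

(* The subgroup of the free abelian group on P * L generated by the          *)
(* biadditivity and R-balancedness relations.                                *)
Inductive tensor_rel : free -> Prop :=
| tensor_rel0 : tensor_rel 0
| tensor_relB x y : tensor_rel x -> tensor_rel y -> tensor_rel (x - y)
| tensor_relDl p p' l :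
    tensor_rel (<< (p + p', l) >> - (<< (p, l) >> + << (p', l) >>))
| tensor_relDr p l l' :
    tensor_rel (<< (p, l + l') >> - (<< (p, l) >> + << (p, l') >>))
| tensor_relZ (r : R) p l :
    tensor_rel (<< ((r : R^c) *: p, l) >> - << (p, r *: l) >>).

Definition tensor_pred : {pred free} := [pred x | `[< tensor_rel x >]].

Lemma tensor_pred_zmod : zmod_closed tensor_pred.
Proof.
split=> [|x y]; rewrite !inE; first exact/asboolP/tensor_rel0.
by move=> /asboolP hx /asboolP hy; apply/asboolP/tensor_relB.
Qed.

HB.instance Definition _ :=
  GRing.isZmodClosed.Build free tensor_pred tensor_pred_zmod.

Definition tensor := Quotient.quot tensor_pred.

Definition tens (p : P) (l : L) : tensor := \pi_tensor << (p, l) >>.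

Section Lift.
Variables (A : zmodType) (b : P -> L -> A).

Definition tensor_lift (t : tensor) : A :=
  fglift (fun x : P * L => b x.1 x.2 : zmodule A) (repr t).

Hypothesis bDl : forall p p' l, b (p + p') l = b p l + b p' l.
Hypothesis bDr : forall p l l', b p (l + l') = b p l + b p l'.
Hypothesis bZ : forall (r : R) p l, b ((r : R^c) *: p) l = b p (r *: l).

#[local] HB.instance Definition _ :=
  GRing.isZmodMorphism.Build free (zmodule A)
    (fglift (fun x : P * L => b x.1 x.2 : zmodule A)) (lift_is_additive _).

Lemma tensor_lift_pi (x : free) :
  tensor_lift (\pi_tensor x) =
  fglift (fun x : P * L => b x.1 x.2 : zmodule A) x.
Proof.
set f := fun x : P * L => b x.1 x.2 : zmodule A.
have fU y : fglift f << y >> = f y by rewrite liftU scale1r.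
have f0 y : tensor_rel y -> fglift f y = 0.
  elim=> [|u v _ hu _ hv|p p' l|p l l'|r p l].
  - exact: raddf0.
  - by rewrite raddfB /= hu hv subr0.
  - by rewrite raddfB raddfD /= !fU /f /= bDl subrr.
  - by rewrite raddfB raddfD /= !fU /f /= bDr subrr.
  - by rewrite raddfB /= !fU /f /= bZ subrr.
rewrite /tensor_lift; apply/eqP; rewrite -subr_eq0 -raddfB; apply/eqP/f0.
have : repr (\pi_tensor x) - x \in tensor_pred.
  by rewrite Quotient.idealrBE reprK.
by rewrite inE => /asboolP.
Qed.

Lemma tensor_lift_tens p l : tensor_lift (tens p l) = b p l.
Proof. by rewrite tensor_lift_pi liftU scale1r. Qed.

Lemma tensor_liftD : {morph tensor_lift : s t / s + t}.
Proof.
move=> s t; rewrite -[s]reprK -[t]reprK -[X in tensor_lift X]raddfD.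
by rewrite !tensor_lift_pi raddfD.
Qed.

End Lift.

Lemma tensDl p p' l : tens (p + p') l = tens p l + tens p' l.
Proof.
rewrite /tens -raddfD; apply/eqP; rewrite -Quotient.idealrBE inE.
exact/asboolP/tensor_relDl.
Qed.

Lemma tensDr p l l' : tens p (l + l') = tens p l + tens p l'.
Proof.
rewrite /tens -raddfD; apply/eqP; rewrite -Quotient.idealrBE inE.
exact/asboolP/tensor_relDr.
Qed.

Lemma tensZ (r : R) p l : tens ((r : R^c) *: p) l = tens p (r *: l).
Proof.
apply/eqP; rewrite -Quotient.idealrBE inE; exact/asboolP/tensor_relZ.
Qed.

End Tensor.

Definition tensor_map (R : pzRingType) (P Q : lmodType R^c)
    (f : {linear P -> Q}) (L : lmodType R) : tensor P L -> tensor Q L :=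
  tensor_lift (fun p l => tens (f p) l).

Section TensorMap.
Variables (R : pzRingType) (P Q : lmodType R^c) (f : {linear P -> Q}).
Variable L : lmodType R.

Lemma tensor_map_tens p (l : L) : tensor_map f (tens p l) = tens (f p) l.
Proof.
apply: tensor_lift_tens => [p1 p2 m|p1 m m'|r p1 m].
- by rewrite linearD tensDl.
- by rewrite tensDr.
- by rewrite linearZ tensZ.
Qed.

Lemma tensor_mapD : {morph @tensor_map R P Q f L : s t / s + t}.
Proof.
apply: tensor_liftD => [p1 p2 m|p1 m m'|r p1 m].
- by rewrite linearD tensDl.
- by rewrite tensDr.
- by rewrite linearZ tensZ.
Qed.

End TensorMap.

Section Gorenstein.
Variable R : pzRingType.
Implicit Types M A L : lmodType R.

(* Ext^1_R(F, A) = H^1 (Hom_R(P_*, A)) and Tor_1^R(F, L) = H_1 (P_* (x) L)   *)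
(* for a projective resolution P_* of F; they do not depend on P_*           *)
Definition Ext1_eq0 (F A : lmodType R) : Prop :=
  forall (P : nat -> lmodType R) (d : forall i, {linear P i.+1 -> P i})
         (e : {linear P 0%N -> F}),
    projective_resolution d e ->
    forall g : {linear P 1%N -> A},
      g \o d 1%N =1 \0 <-> exists h : {linear P 0%N -> A}, h \o d 0%N =1 g.

Definition Tor1_eq0 (F : lmodType R^c) (L : lmodType R) : Prop :=
  forall (P : nat -> lmodType R^c) (d : forall i, {linear P i.+1 -> P i})
         (e : {linear P 0%N -> F}),
    projective_resolution d e ->
    exact_at (@tensor_map R _ _ (d 1%N) L) (@tensor_map R _ _ (d 0%N) L).

Definition absolutely_clean A : Prop :=
  forall F : lmodType R, FP_infty F -> Ext1_eq0 F A.

Definition level L : Prop :=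
  forall F : lmodType R^c, FP_infty F -> Tor1_eq0 F L.

Definition exact_complex (X : int -> lmodType R)
    (d : forall i : int, {linear X (i + 1) -> X i}) : Prop :=
  forall i, exact_at (d (i + 1)) (d i).

(* The complex Hom_R(X, L) is exact. *)
Definition Hom_to_exact (X : int -> lmodType R)
    (d : forall i : int, {linear X (i + 1) -> X i}) L : Prop :=
  forall (i : int) (g : {linear X (i + 1) -> L}),
    g \o d (i + 1) =1 \0 <-> exists h : {linear X i -> L}, h \o d i =1 g.

(* The complex Hom_R(A, X) is exact. *)
Definition Hom_from_exact (X : int -> lmodType R)
    (d : forall i : int, {linear X (i + 1) -> X i}) A : Prop :=
  forall (i : int) (g : {linear A -> X (i + 1)}),
    d i \o g =1 \0 <->
    exists h : {linear A -> X (i + 1 + 1)}, d (i + 1) \o h =1 g.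

(* M is isomorphic to Coker f iff U -> V -> M -> 0 is exact for some V -> M. *)
Definition is_coker (U V : lmodType R) (f : {linear U -> V}) M : Prop :=
  exists q : {linear V -> M}, exact_at f q /\ surj q.

Definition Gorenstein_projective_wrt (C : lmodType R -> Prop) M : Prop :=
  exists (X : int -> lmodType R)
         (d : forall i : int, {linear X (i + 1) -> X i}),
    [/\ forall i, projective (X i), exact_complex d, is_coker (d 0) M
      & forall L, C L -> Hom_to_exact d L].

Definition Gorenstein_projective : lmodType R -> Prop :=
  Gorenstein_projective_wrt (@projective R).

Definition Gorenstein_AC_projective : lmodType R -> Prop :=
  Gorenstein_projective_wrt level.

Definition Gorenstein_AC_injective M : Prop :=
  exists (X : int -> lmodType R)
         (d : forall i : int, {linear X (i + 1) -> X i}),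
    [/\ forall i, injective_module (X i), exact_complex d, is_coker (d 0) M
      & forall A, absolutely_clean A -> Hom_from_exact d A].

(* 0 -> G n -> ... -> G 0 -> M -> 0, encoded with G i = 0 for i > n          *)
Definition resolution_dim_le (C : lmodType R -> Prop) (n : nat) M : Prop :=
  exists (G : nat -> lmodType R) (d : forall i, {linear G i.+1 -> G i})
         (e : {linear G 0%N -> M}),
    [/\ resolution d e, forall i, (i <= n)%N -> C (G i)
      & forall i, (n < i)%N -> forall x : G i, x = 0].

(* 0 -> M -> G 0 -> ... -> G n -> 0, encoded with G i = 0 for i > n          *)
Definition coresolution_dim_le (C : lmodType R -> Prop) (n : nat) M : Prop :=
  exists (G : nat -> lmodType R) (d : forall i, {linear G i -> G i.+1})
         (e : {linear M -> G 0%N}),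
    [/\ injective e /\ exact_at e (d 0%N),
        forall i, exact_at (d i) (d i.+1),
        forall i, (i <= n)%N -> C (G i)
      & forall i, (n < i)%N -> forall x : G i, x = 0].

Definition Gpd_le := resolution_dim_le Gorenstein_projective.
Definition GPac_dim_le := resolution_dim_le Gorenstein_AC_projective.
Definition GIac_dim_le := coresolution_dim_le Gorenstein_AC_injective.

End Gorenstein.

(* A supremum of dimensions in {0, 1, 2, ...} U {oo} is finite exactly when   *)
(* some natural number bounds all of them.                                    *)
Definition Ggldim_finite (R : pzRingType) : Prop :=
  exists n, forall M : lmodType R, Gpd_le n M.

Definition GPac_gldim_finite (R : pzRingType) : Prop :=
  exists n, forall M : lmodType R, GPac_dim_le n M.

Definition GIac_gldim_finite (R : pzRingType) : Prop :=
  exists n, forall M : lmodType R, GIac_dim_le n M.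

(* Main.v *)
From HB Require Import structures.
From mathcomp Require Import all_boot all_algebra.
From mathcomp Require Import boolp classical_sets functions wochoice.
From mathcomp.finmap Require Import finmap.
From mathcomp.multinomials Require Import freeg.
Require Import Defs.

(** The theorem rests on two facts about a ring all of whose modules have
    Gorenstein projective dimension at most [n].

    The first concerns the modules [T] for which Hom (X, T) is exact for every
    totally acyclic complex X of projectives ([tot_test]).  Projectives and
    injectives are such modules, and two out of three members of a short exact
    sequence suffice.  As Ext^(n+1) (M, T) = 0 for every [M] ([Gpd_orth]), these
    modules have projective and injective dimension at most [n] ([tot_test_pd],
    [tot_test_id]).  In particular injectives have finite projective dimension
    and projectives finite injective dimension.  It follows, by the horseshoe
    lemma, that the class of n-th cosyzygies of all modules is periodic: each
    member is the cokernel of a member in an injective module, and a cosyzygy of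
    a member is a member ([cosyz_class_periodic]).  Splicing shows that a member
    is a cycle of an acyclic complex of injectives with cycles in the class; the
    member is Gorenstein AC-injective as soon as the absolutely clean modules
    are orthogonal to the class ([periodic_Gorenstein_AC_injective]), where
    orthogonality of [A] means Ext^1 (A, C) = 0 for all [C] in the class.

    The second fact is that over any ring flat modules are orthogonal to every
    periodic class ([flat_orth]).  By periodicity the orthogonal modules are
    closed under cokernels of monomorphisms, and by Eklof's lemma under
    well-ordered filtrations.  These two properties imply closure under directed
    unions ([directed_union_orth]).  A flat module is the quotient of a free
    module by a submodule that is a directed union of finite free modules, as in
    Lazard's theorem ([fin_free_cover]), so that it is orthogonal.

    Over a right coherent ring a level module [L] is flat ([level_flat]).  Flat
    and injective modules being orthogonal to the class of n-th cosyzygies, the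
    n-th cosyzygy of [L] is orthogonal to the class that contains it, hence
    injective.  So [L] has finite injective dimension and Hom (X, L) is exact
    for every totally acyclic X ([flat_tot_test]): Gorenstein projective modules
    are Gorenstein AC-projective.

    Over a left coherent ring an absolutely clean module is pure in any module
    that contains it ([absolutely_clean_pure]), in particular in an injective
    one, which has finite projective dimension.  Syzygies preserve purity and a
    pure submodule of a projective is flat, so that an absolutely clean module
    has finite flat dimension; it is therefore orthogonal to the class of n-th
    cosyzygies ([pure_orth]), and the n-th cosyzygy of any module is Gorenstein
    AC-injective. *)

Set Implicit Arguments.
Unset Strict Implicit.
Unset Printing Implicit Defensive.

Import GRing.Theory.
Local Open Scope ring_scope.
Local Open Scope quotient_scope.

(** * Linear maps, submodules and quotients *)

Section LinearTools.
Variable R : pzRingType.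
Implicit Types U V W K F L M : lmodType R.

Lemma linear_ex U V (f : U -> V) :
  (forall a x y, f (a *: x + y) = a *: f x + f y) ->
  exists F : {linear U -> V}, F =1 f.
Proof.
move=> hf.
exists (HB.pack_for {linear U -> V} f (GRing.isLinear.Build R U V _ f hf)).
by [].
Qed.

(** Linear maps are most often obtained from a relation with a unique value at
    every point; uniqueness at zero suffices, by linearity. *)
Lemma linear_of_rel U V (G : U -> V -> Prop) :
  (forall x, exists y, G x y) -> (forall y, G 0 y -> y = 0) ->
  (forall a x y x' y', G x y -> G x' y' -> G (a *: x + x') (a *: y + y')) ->
  exists F : {linear U -> V}, forall x, G x (F x).
Proof.
move=> tot fn lin; have [f Gf] := choice tot.
have uniq x y y' : G x y -> G x y' -> y = y'.
  move=> h h'; apply/eqP; rewrite -subr_eq0; apply/eqP/fn.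
  have := lin (-1) _ _ _ _ h' h.
  by rewrite !scaleN1r addNr addrC.
have [F FE] : exists F : {linear U -> V}, F =1 f.
  by apply: linear_ex => a x y; apply: uniq (Gf _) _; apply: lin.
by exists F => x; rewrite FE.
Qed.

Lemma factor_surj U W V (g : {linear U -> W}) (f : {linear U -> V}) :
  surj g -> (forall x, g x = 0 -> f x = 0) ->
  exists h : {linear W -> V}, forall x, h (g x) = f x.
Proof.
move=> gs ker.
have [|y [x + <-]||h hP] :=
  @linear_of_rel W V (fun w v => exists2 x, g x = w & f x = v).
- by move=> w; have [x <-] := gs w; exists (f x), x.
- exact: ker.
- move=> a _ _ _ _ [x <- <-] [x' <- <-].
  by exists (a *: x + x'); rewrite linearP.
exists h => x; have [x' e <-] := hP (g x).
by apply/eqP; rewrite -subr_eq0 -linearB ker // linearB e subrr.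
Qed.

Lemma factor_inj U W V (i : {linear W -> V}) (f : {linear U -> V}) :
  injective i -> (forall u, exists w, i w = f u) ->
  exists h : {linear U -> W}, forall u, i (h u) = f u.
Proof.
move=> ii im; have [||h hP] := @linear_of_rel U W (fun u w => i w = f u) im.
- by move=> y; rewrite linear0 -{1}(linear0 i) => /ii.
- by move=> a x y x' y' hx hx'; rewrite !linearP hx hx'.
by exists h.
Qed.

Lemma injP U V (f : {linear U -> V}) :
  (forall x, f x = 0 -> x = 0) -> injective f.
Proof.
move=> h x y e; apply/eqP; rewrite -subr_eq0; apply/eqP/h.
by rewrite linearB e subrr.
Qed.

Definition submod V (S : V -> Prop) : Prop :=
  S 0 /\ forall a x y, S x -> S y -> S (a *: x + y).

Section SubmodTheory.
Variables (V : lmodType R) (S : V -> Prop).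
Hypothesis hS : submod S.

Lemma submod0 : S 0. Proof. by case: hS. Qed.

Lemma submodD x y : S x -> S y -> S (x + y).
Proof. by move=> hx hy; rewrite -[x]scale1r; apply: hS.2. Qed.

Lemma submodZ a x : S x -> S (a *: x).
Proof. by move=> hx; rewrite -[_ *: _]addr0; apply: hS.2 submod0. Qed.

Lemma submodN x : S x -> S (- x).
Proof. by rewrite -scaleN1r; apply: submodZ. Qed.

Lemma submodB x y : S x -> S y -> S (x - y).
Proof. by move=> hx /submodN; apply: submodD. Qed.

Lemma submod_sum (I : Type) (r : seq I) (F : I -> V) :
  (forall i, S (F i)) -> S (\sum_(i <- r) F i).
Proof.
by move=> h; elim/big_ind: _ => //; [apply: submod0 | apply: submodD].
Qed.

Definition submod_pred : {pred V} := fun x => `[< S x >].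

Lemma submod_pred_closed : subsemimod_closed submod_pred.
Proof.
split; first split.
- exact/asboolP/submod0.
- by move=> x y /asboolP hx /asboolP hy; apply/asboolP/submodD.
- by move=> a x /asboolP hx; apply/asboolP/submodZ.
Qed.

End SubmodTheory.
End LinearTools.

Section SubmoduleType.
Variables (R : pzRingType) (V : lmodType R) (S : V -> Prop) (hS : submod S).

Record submod_type : Type := Submod
  { submod_val : V; _ : submod_pred S submod_val }.

HB.instance Definition _ := [isSub for submod_val].
HB.instance Definition _ := [Choice of submod_type by <:].
HB.instance Definition _ := GRing.SubChoice_isSubLmodule.Build R V
  (submod_pred S) submod_type (submod_pred_closed hS).

Lemma submodule_ex : exists (W : lmodType R) (i : {linear W -> V}),
  injective i /\ forall v, S v <-> exists w, i w = v.
Proof.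
exists submod_type, (\val : {linear submod_type -> V}).
split; first exact: val_inj.
move=> v; split=> [hv|[[w hw] <-]]; last exact/asboolP.
by exists (Submod (asboolT hv)).
Qed.

End SubmoduleType.

Section QuotientModule.
Variables (R : pzRingType) (V : lmodType R) (S : V -> Prop) (hS : submod S).

Definition quot_pred : {pred V} := fun x => `[< S x >].

Lemma quot_pred_zmod : zmod_closed quot_pred.
Proof.
split=> [|x y /asboolP hx /asboolP hy]; apply/asboolP; first exact: submod0.
exact: submodB.
Qed.

HB.instance Definition _ := GRing.isZmodClosed.Build V quot_pred quot_pred_zmod.

Definition quot_mod := Quotient.quot quot_pred.

Lemma quot_piE x y : \pi_quot_mod x = \pi_quot_mod y <-> S (x - y).
Proof.
split=> [/eqP|h]; last apply/eqP; rewrite -Quotient.idealrBE.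
  by move/asboolP.
exact/asboolP.
Qed.

Lemma quot_piD x y :
  \pi_quot_mod (x + y) = \pi_quot_mod x + \pi_quot_mod y :> quot_mod.
Proof. exact: raddfD. Qed.

Lemma quot_piP q : exists x, q = \pi_quot_mod x.
Proof. by exists (repr q); rewrite reprK. Qed.

Definition quot_scale (a : R) (q : quot_mod) : quot_mod :=
  \pi_quot_mod (a *: repr q).

Lemma quot_scale_pi a x : quot_scale a (\pi_quot_mod x) = \pi_quot_mod (a *: x).
Proof.
apply/quot_piE; rewrite -scalerBr; apply: submodZ => //.
by apply/quot_piE; rewrite reprK.
Qed.

Fact quot_scaleA a b q : quot_scale a (quot_scale b q) = quot_scale (a * b) q.
Proof. by have [x ->] := quot_piP q; rewrite !quot_scale_pi scalerA. Qed.

Fact quot_scale1 : left_id 1 quot_scale.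
Proof.
by move=> q; have [x ->] := quot_piP q; rewrite quot_scale_pi scale1r.
Qed.

Fact quot_scaleDr : right_distributive quot_scale +%R.
Proof.
move=> a q q'; have [[x ->] [y ->]] := (quot_piP q, quot_piP q').
by rewrite -quot_piD !quot_scale_pi scalerDr quot_piD.
Qed.

Fact quot_scaleDl q : {morph quot_scale^~ q : a b / a + b}.
Proof.
move=> a b; have [x ->] := quot_piP q.
by rewrite !quot_scale_pi scalerDl quot_piD.
Qed.

HB.instance Definition _ := GRing.Zmodule.on quot_mod.
HB.instance Definition _ := GRing.Zmodule_isLmodule.Build R quot_mod
  quot_scaleA quot_scale1 quot_scaleDr quot_scaleDl.

Lemma quotient_ex : exists (Q : lmodType R) (p : {linear V -> Q}),
  surj p /\ forall v, p v = 0 <-> S v.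
Proof.
have [|p pE] := @linear_ex R V quot_mod (fun x => \pi_quot_mod x).
  by move=> a x y; rewrite quot_piD -quot_scale_pi.
exists quot_mod, p; split=> [|v].
  by move=> q; exists (repr q); rewrite pE reprK.
rewrite pE -[X in S X]subr0 -quot_piE.
by have /= -> := raddf0 \pi_quot_mod.
Qed.

End QuotientModule.

(** * Short exact sequences, projective and injective modules *)

Section ShortExact.
Variable R : pzRingType.
Implicit Types A B U V W K F L M P I : lmodType R.

Definition ses K F L (f : {linear K -> F}) (g : {linear F -> L}) : Prop :=
  [/\ injective f, exact_at f g & surj g].

Lemma ker_submod U V (f : {linear U -> V}) : submod (fun x => f x = 0).
Proof.
by split=> [|a x y hx hy]; rewrite ?linear0 // linearP hx hy scaler0 addr0.
Qed.

Lemma img_submod U V (f : {linear U -> V}) :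
  submod (fun y => exists x, f x = y).
Proof.
split=> [|a _ _ [x <-] [y <-]]; first by exists 0; rewrite linear0.
by exists (a *: x + y); rewrite linearP.
Qed.

Lemma ses_of_surj F L (g : {linear F -> L}) :
  surj g -> exists K (f : {linear K -> F}), ses f g.
Proof.
have [K [f [fi fE]]] := submodule_ex (ker_submod g).
by exists K, f; split.
Qed.

Lemma ses_of_inj K F (f : {linear K -> F}) :
  injective f -> exists L (g : {linear F -> L}), ses f g.
Proof.
have [L [g [gs gE]]] := quotient_ex (img_submod f).
by exists L, g; split.
Qed.

Section Factor.
Variables (K F L : lmodType R) (f : {linear K -> F}) (g : {linear F -> L}).
Hypothesis S : ses f g.

Lemma ses_comp x : g (f x) = 0.
Proof. by case: S => _ e _; apply/e; exists x. Qed.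

Lemma ses_ker y : g y = 0 -> exists x, f x = y.
Proof. by case: S => _ e _ /e. Qed.

Lemma ses_lift U (h : {linear U -> F}) : (forall u, g (h u) = 0) ->
  exists h' : {linear U -> K}, forall u, f (h' u) = h u.
Proof.
by case: S => fi e _ gh; apply: factor_inj => // u; apply/e.
Qed.

Lemma ses_desc U (h : {linear F -> U}) : (forall x, h (f x) = 0) ->
  exists h' : {linear L -> U}, forall y, h' (g y) = h y.
Proof.
case: S => fi e gs hf; apply: factor_surj => // y /e [x <-]; exact: hf.
Qed.

End Factor.

Lemma inj_extend I A B (f : {linear A -> B}) (g : {linear A -> I}) :
  injective_module I -> injective f ->
  exists h : {linear B -> I}, forall x, h (f x) = g x.
Proof. by move=> hI /(hI _ _ f g) [h hE]; exists h => x; apply: hE. Qed.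

(** Only the values of [g] have to be reached by [f]: corestrict [f] to its
    image. *)
Lemma proj_lift P A B (f : {linear A -> B}) (g : {linear P -> B}) :
  projective P -> (forall x, exists y, f y = g x) ->
  exists h : {linear P -> A}, forall x, f (h x) = g x.
Proof.
move=> hP im.
have [B' [i [ii iE]]] := submodule_ex (img_submod f).
have [g' g'E] := factor_inj ii (fun x => (iE (g x)).1 (im x)).
have [f' f'E] := factor_inj ii (fun y => (iE (f y)).1 (ex_intro _ y erefl)).
have f's : surj f'.
  by move=> b; have [y ey] := (iE (i b)).2 (ex_intro _ b erefl);
     exists y; apply: ii; rewrite f'E.
by have [h hE] := hP _ _ f' g' f's; exists h => x; rewrite -f'E [f' _]hE.
Qed.

Lemma injective_retract I M (i : {linear M -> I}) (p : {linear I -> M}) :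
  injective_module I -> (forall x, p (i x) = x) -> injective_module M.
Proof.
move=> hI pi A B f g fi.
have [h hE] := @inj_extend I A B f (i \o g) hI fi.
by exists (p \o h) => x /=; rewrite hE /= pi.
Qed.

Lemma projective_retract P M (i : {linear M -> P}) (p : {linear P -> M}) :
  projective P -> (forall x, p (i x) = x) -> projective M.
Proof.
move=> hP pi A B f g fs.
have [h hE] := @proj_lift P A B f (g \o p) hP (fun x => fs _).
by exists (h \o i) => x /=; rewrite hE /= pi.
Qed.

Section Pairs.
Variables U V : lmodType R.

Lemma pair_maps W (f : {linear W -> U}) (g : {linear W -> V}) :
  exists h : {linear W -> (U * V)%type}, forall w, h w = (f w, g w).
Proof. by apply: linear_ex => a x y; rewrite !linearP. Qed.

Lemma copair_maps W (f : {linear U -> W}) (g : {linear V -> W}) :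
  exists h : {linear (U * V)%type -> W}, forall u v, h (u, v) = f u + g v.
Proof.
have [|h hE] := @linear_ex R (U * V)%type W (fun w => f w.1 + g w.2).
  by move=> a [x x'] [y y'] /=; rewrite !linearP scalerDr addrACA.
by exists h => u v; rewrite hE.
Qed.

Lemma pair_injective :
  injective_module U -> injective_module V -> injective_module (U * V)%type.
Proof.
move=> hU hV A B f g fi.
have [h hE] := @inj_extend U A B f (fst \o g) hU fi.
have [k kE] := @inj_extend V A B f (snd \o g) hV fi.
have [l lE] := pair_maps h k.
by exists l => x /=; rewrite lE hE kE /=; case: (g x).
Qed.

Lemma pair_projective :
  projective U -> projective V -> projective (U * V)%type.
Proof.
move=> hU hV A B f g fs.
have [i iE] := pair_maps (idfun : {linear U -> U}) (\0 : {linear U -> V}).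
have [j jE] := pair_maps (\0 : {linear V -> U}) (idfun : {linear V -> V}).
have [h hE] := @proj_lift U A B f (g \o i) hU (fun x => fs _).
have [k kE] := @proj_lift V A B f (g \o j) hV (fun x => fs _).
have [l lE] := copair_maps h k.
exists l => -[u v] /=; rewrite lE linearD hE kE /= -linearD iE jE.
by congr (g _); congr (_, _); rewrite /= ?addr0 ?add0r.
Qed.

End Pairs.

End ShortExact.

(** * Free modules and enough projectives *)

Section FreeModules.
Variable R : pzRingType.
Implicit Types A B K M P : lmodType R.

Section Rows.
Variable n : nat.

Lemma rV_map M (v : 'I_n -> M) :
  exists h : {linear 'rV[R]_n -> M}, forall u, h u = \sum_i u 0 i *: v i.
Proof.
apply: linear_ex => a x y; rewrite scaler_sumr -big_split /=.
by apply: eq_bigr => i _; rewrite !mxE scalerDl scalerA.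
Qed.

Lemma rV_expand M (h : {linear 'rV[R]_n -> M}) u :
  h u = \sum_i u 0 i *: h (delta_mx 0 i).
Proof.
rewrite {1}[u]row_sum_delta linear_sum.
by apply: eq_bigr => i _; rewrite linearZ.
Qed.

Lemma rV_delta M (v : 'I_n -> M) (h : {linear 'rV[R]_n -> M}) :
  (forall u, h u = \sum_i u 0 i *: v i) -> forall i, h (delta_mx 0 i) = v i.
Proof.
move=> hE i; rewrite hE (bigD1 i) //= big1 => [|j ne].
  by rewrite mxE !eqxx scale1r addr0.
by rewrite mxE (negbTE ne) andbF scale0r.
Qed.

Lemma rV_projective : projective 'rV[R]_n.
Proof.
move=> A B f g fs.
have [v vE] := choice (fun i : 'I_n => fs (g (delta_mx 0 i))).
have [h hE] := rV_map v; exists h => u /=.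
rewrite hE linear_sum [RHS]rV_expand.
by apply: eq_bigr => i _; rewrite linearZ /= vE.
Qed.

Lemma rV_fin_gen : fin_gen 'rV[R]_n.
Proof.
exists n, (fun i => delta_mx 0 i) => u; exists (u 0).
exact: row_sum_delta.
Qed.

End Rows.

Section FiniteSupport.
Variable T : choiceType.

Lemma sum_subset (V : nmodType) (s s' : seq T) (F : T -> V) :
  uniq s -> uniq s' -> {subset s <= s'} -> (forall t, t \notin s -> F t = 0) ->
  \sum_(t <- s') F t = \sum_(t <- s) F t.
Proof.
move=> us us' ss F0.
rewrite (bigID (mem s)) /= [X in _ + X]big1 ?addr0; last by move=> i /F0.
rewrite -big_filter; apply: perm_big; apply: uniq_perm => //.
  exact: filter_uniq.
move=> t; rewrite mem_filter /=.
by case: (boolP (t \in s)) => // /ss ->.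
Qed.

Definition fin_supp (f : T -> R^o) : Prop :=
  exists s : seq T, forall t, t \notin s -> f t = 0.

Lemma fin_supp_submod : submod fin_supp.
Proof.
split=> [|a f g [s hs] [s' hs']]; first by exists [::].
exists (s ++ s') => t; rewrite mem_cat negb_or => /andP[/hs h /hs' h'].
by rewrite [LHS](_ : _ = a *: f t + g t) // h h' scaler0 addr0.
Qed.

(** The expansion of an element is given along every list that contains its
    support, so that finitely many elements have expansions along a common
    list. *)
Lemma free_ex : exists (F : lmodType R) (b : T -> F)
    (c : T -> {linear F -> R^o}),
  [/\ forall t t', c t (b t') = (t == t')%:R,
      forall x, exists2 s : seq T, uniq s & forall s', uniq s' ->
        {subset s <= s'} -> x = \sum_(t <- s') (c t x : R) *: b t
    & forall M (v : T -> M),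
        exists h : {linear F -> M}, forall t, h (b t) = v t].
Proof.
have [F [i [ii iE]]] := submodule_ex fin_supp_submod.
have dP t : fin_supp (fun t' => (t' == t)%:R : R^o).
  by exists [:: t] => t'; rewrite inE => /negbTE ->.
have [b bE] := choice (fun t => (iE _).1 (dP t)).
have cP t : exists c : {linear F -> R^o}, forall x, c x = i x t.
  by apply: linear_ex => a x y; rewrite linearP.
have [c cE] := choice cP.
have supp x : exists2 s : seq T, uniq s & forall t, t \notin s -> c t x = 0.
  have [s hs] := (iE (i x)).2 (ex_intro _ x erefl).
  exists (undup s); first exact: undup_uniq.
  by move=> t; rewrite mem_undup cE => /hs.
have cb t t' : c t (b t') = (t == t')%:R by rewrite cE bE.
exists F, b, c; split=> //.
  move=> x; have [s us hs] := supp x; exists s => // s' us' ss'.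
  apply: ii; apply/funext => t; rewrite -!cE linear_sum.
  under eq_bigr do rewrite linearZ /= cb.
  have [ts|tNs] := boolP (t \in s').
    rewrite (bigD1_seq t) //= eqxx big1 => [|t' ne].
      by rewrite addr0 /GRing.scale /= mulr1.
    by rewrite eq_sym (negbTE ne) scaler0.
  rewrite hs; last by apply: contra tNs => /ss'.
  rewrite big1_seq // => t' /andP[_ t's].
  have [e|] := eqVneq t t'; last by rewrite scaler0.
  by rewrite e t's in tNs.
move=> M v.
pose G x m := exists2 s : seq T, uniq s /\ (forall t, t \notin s -> c t x = 0)
  & m = \sum_(t <- s) (c t x : R) *: v t.
have [|||h hG] := @linear_of_rel R F M G.
- move=> x; have [s us hs] := supp x.
  by exists (\sum_(t <- s) (c t x : R) *: v t), s.
- by move=> y [s _ ->]; rewrite big1 // => t _; rewrite linear0 scale0r.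
- move=> a x y x' y' [s [us hs] ->] [s' [us' hs'] ->].
  exists (undup (s ++ s')).
    split=> [|t]; first exact: undup_uniq.
    rewrite mem_undup mem_cat negb_or => /andP[/hs e /hs' e'].
    by rewrite linearP e e' scaler0 addr0.
  have h1 (r : seq T) z : uniq r -> {subset r <= s ++ s'} ->
      (forall t, t \notin r -> c t z = 0) ->
      \sum_(t <- r) (c t z : R) *: v t =
      \sum_(t <- undup (s ++ s')) (c t z : R) *: v t.
    move=> ur rs r0; apply/esym/sum_subset; rewrite ?undup_uniq //.
      by move=> t /rs; rewrite mem_undup.
    by move=> t /r0 ->; rewrite scale0r.
  rewrite (h1 s) //; last by move=> t; rewrite mem_cat => ->.
  rewrite (h1 s') //; last by move=> t; rewrite mem_cat orbC => ->.
  rewrite scaler_sumr -big_split; apply: eq_bigr => t _ /=.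
  by rewrite linearP scalerDl scalerA.
exists h => t; have [s [us hs] ->] := hG (b t).
have [ts|/hs] := boolP (t \in s); last first.
  rewrite cb eqxx => e.
  have z (m : M) : m = 0 by rewrite -[m]scale1r (_ : 1 = 0) ?scale0r.
  by rewrite [RHS]z [LHS]z.
rewrite (bigD1_seq t) //= cb eqxx scale1r big1 ?addr0 // => t' ne.
by rewrite cb (negbTE ne) scale0r.
Qed.

End FiniteSupport.

Lemma free_projective_ex (T : choiceType) : exists (F : lmodType R) (b : T -> F)
    (c : T -> {linear F -> R^o}),
  [/\ projective F, forall t t', c t (b t') = (t == t')%:R,
      forall x, exists2 s : seq T, uniq s & forall s', uniq s' ->
        {subset s <= s'} -> x = \sum_(t <- s') (c t x : R) *: b t
    & forall M (v : T -> M),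
        exists h : {linear F -> M}, forall t, h (b t) = v t].
Proof.
have [F [b [c [cb ex uni]]]] := free_ex T; exists F, b, c; split=> //.
move=> A B f g fs.
have [v vE] := choice (fun t => fs (g (b t))).
have [h hE] := uni _ v; exists h => x /=.
have [s us sE] := ex x; rewrite [x](sE s) // !linear_sum.
by apply: eq_bigr => t _; rewrite !linearZ /= hE vE.
Qed.

Lemma enough_projectives M :
  exists P (p : {linear P -> M}), projective P /\ surj p.
Proof.
have [F [b [c [Fp _ _ uni]]]] := free_projective_ex M.
have [p pE] := uni M id; exists F, p; split=> // m.
by exists (b m); rewrite pE.
Qed.

Lemma ses_projective M :
  exists K P (f : {linear K -> P}) (g : {linear P -> M}),
    projective P /\ ses f g.
Proof.
have [P [g [hP gs]]] := enough_projectives M.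
by have [K [f S]] := ses_of_surj gs; exists K, P, f, g.
Qed.

End FreeModules.

(** * Enough injectives *)

Lemma mulrz_euclid (B : zmodType) (b : B) (k : int) (n : nat) :
  b *~ k = (b *+ n) *~ (k %/ n)%Z + b *~ (k %% n)%Z.
Proof.
by rewrite {1}(divz_eq k n) mulrzDr [((k %/ n)%Z * n)%R]mulrC mulrzA.
Qed.

Section DivisibleExtension.
Variables B D : zmodType.
Hypothesis divD : forall n (d : D), (0 < n)%N -> exists d', d' *+ n = d.

(** Partial additive maps are represented by their graphs, so that a chain of
    them has its union as an upper bound. *)
Definition partial_hom (G : B -> D -> Prop) : Prop :=
  [/\ G 0 0, forall d, G 0 d -> d = 0
    & forall x d y e, G x d -> G y e -> G (x - y) (d - e)].

Lemma partial_homN G x d : partial_hom G -> G x d -> G (- x) (- d).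
Proof. by case=> z _ sub h; rewrite -[- x]sub0r -[- d]sub0r; apply: sub. Qed.

Lemma partial_homD G x d y e :
  partial_hom G -> G x d -> G y e -> G (x + y) (d + e).
Proof.
move=> hG hx /(partial_homN hG); case: hG => _ _ sub.
by move/(sub _ _ _ _ hx); rewrite !opprK.
Qed.

Lemma partial_homMz G x d (k : int) :
  partial_hom G -> G x d -> G (x *~ k) (d *~ k).
Proof.
move=> hG hx.
have hn n : G (x *+ n) (d *+ n).
  elim: n => [|n IH]; first by case: hG.
  by rewrite !mulrS; apply: partial_homD.
case: k => n; first exact: hn.
by rewrite NegzE !mulrNz; apply: partial_homN (hn n.+1).
Qed.

Lemma partial_hom_uniq G x d d' : partial_hom G -> G x d -> G x d' -> d = d'.
Proof.
case=> _ fn sub h h'; apply/eqP; rewrite -subr_eq0; apply/eqP/fn.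
by rewrite -(subrr x); apply: sub.
Qed.

(** The multiples of [b] in the domain form a subgroup of the integers;
    dividing the value at its generator gives the value at [b]. *)
Lemma partial_hom_value G b : partial_hom G ->
  exists c, forall k d, G (b *~ k) d -> d = c *~ k.
Proof.
move=> hG; have [G0 fn sub] := hG.
have [[n0 [n0_gt0 [d0 hd0]]]|no] :=
  pselect (exists n : nat, (0 < n)%N /\ exists d, G (b *+ n) d); last first.
  exists 0 => k d hk; rewrite mul0rz.
  have [k0|kn0] := eqVneq k 0; first by apply: fn; rewrite k0 in hk.
  case: no; exists `|k|%N; split; first by rewrite absz_gt0.
  have := partial_homMz (sgz k) hG hk; rewrite -mulrzA mulrC -abszEsg => h.
  by exists (d *~ sgz k).
pose p n := (0 < n)%N && `[< exists d, G (b *+ n) d >].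
have exp : exists n, p n.
  by exists n0; rewrite /p n0_gt0; apply/asboolP; exists d0.
have [n /andP[n_gt0 /asboolP[d1 hd1]] nmin] := ex_minnP exp.
have [c cE] := divD d1 n_gt0; exists c => k d hk.
have n0' : n%:Z != 0 by rewrite eqz_nat -lt0n.
have r0 := modz_ge0 k n0'.
have rlt : (k %% n)%Z < n by rewrite ltz_pmod.
have hr : G (b *~ (k %% n)%Z) (d - d1 *~ (k %/ n)%Z).
  have -> : b *~ (k %% n)%Z = b *~ k - (b *+ n) *~ (k %/ n)%Z.
    by rewrite (mulrz_euclid b k n) addrAC subrr add0r.
  by apply: sub => //; apply: partial_homMz.
have rz : (k %% n)%Z = 0.
  move: hr r0 rlt; case: (k %% n)%Z => // r hr _ rlt.
  have [->//|r_gt0] := posnP r.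
  have /nmin : p r by rewrite /p r_gt0; apply/asboolP; eexists; exact: hr.
  by rewrite leqNgt -ltz_nat rlt.
move: hr; rewrite rz => /fn /eqP; rewrite subr_eq0 => /eqP ->.
by rewrite (mulrz_euclid c k n) rz mulr0z addr0 cE.
Qed.

(** Zorn's lemma on graphs, extending a maximal one by
    [partial_hom_value].  Starting from a graph rather than from a map on a
    subgroup covers both the extension of a homomorphism and the construction
    of characters on a cyclic subgroup. *)
Lemma divisible_extension G0 : partial_hom G0 ->
  exists h : B -> D, (forall x y, h (x - y) = h x - h y) /\
    forall x d, G0 x d -> h x = d.
Proof.
move=> hG0.
pose rel (X : set (B * D)) x d := X (x, d) \/ G0 x d.
pose P : set (set (B * D)) := fun X => partial_hom (rel X).
have chain F : (F `<=` P)%classic -> total_on F classical_sets.subset ->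
    P (bigcup F id).
  move=> FP tot.
  have two x d y e : rel (bigcup F id) x d ->
      rel (bigcup F id) y e ->
      (exists2 X, F X & rel X x d /\ rel X y e) \/ G0 x d /\ G0 y e.
    move=> [[X FX hX]|hX] [[Y FY hY]|hY]; last by right.
    - left; have [XY|YX] := tot _ _ FX FY.
        by exists Y => //; split; left => //; apply: XY.
      by exists X => //; split; left => //; apply: YX.
    - by left; exists X => //; split; [left | right].
    - by left; exists Y => //; split; [right | left].
  have up X x d : F X -> rel X x d -> rel (bigcup F id) x d.
    by move=> FX [h|h]; [left; exists X | right].
  have [z fn sub] := hG0.
  split=> [|d hd|x d y e hx hy].
  - by right.
  - have [[X FX [h _]]|[h _]] := two _ _ _ _ hd hd; last exact: fn.
    by have [_ fX _] := FP _ FX; apply: fX.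
  - have [[X FX [h h']]|[h h']] := two _ _ _ _ hx hy; last by right; apply: sub.
    by apply: (up X) => //; have [_ _ sX] := FP _ FX; apply: sX.
have [X [PX maxX]] := Zorn_bigcup chain.
have tot b : exists d, rel X b d.
  apply: contrapT => nb.
  have [c cE] := partial_hom_value b PX; have [_ fn sub] := PX.
  pose Y : set (B * D) := fun z => exists y e k,
    [/\ rel X y e, z.1 = y + b *~ k & z.2 = e + c *~ k].
  have XY x d : rel X x d -> Y (x, d).
    by move=> h; exists x, d, 0; rewrite !mulr0z !addr0.
  have rY x d : rel Y x d <-> Y (x, d).
    by split=> [[//|h]|h]; [apply: XY; right | left].
  apply: (maxX Y); last first.
    split; first by apply/rY/XY; case: PX.
      move=> d /rY [y [e [k [/= h /eqP]]]].
      rewrite eq_sym addr_eq0 => /eqP yE ->.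
      have := partial_homN PX h; rewrite yE opprK => /cE ee.
      by rewrite -ee subrr.
    move=> x d x' d' /rY [y [e [k [h /= -> ->]]]].
    move=> /rY [y' [e' [k' [h' /= -> ->]]]].
    apply/rY; exists (y - y'), (e - e'), (k - k'); split=> /=.
    - exact: sub.
    - by rewrite mulrzBr opprD addrACA.
    - by rewrite mulrzBr opprD addrACA.
  split=> [[x d] h|YX]; first by apply: XY; left.
  apply: nb; exists c; left; apply: YX; exists 0, 0, 1.
  by rewrite !mulr1z !add0r; split=> //; case: PX.
have [h hE] := choice tot; exists h; split=> [x y|x d hx].
  by apply: (partial_hom_uniq PX (hE _)); case: PX => _ _; apply.
by apply: (partial_hom_uniq PX (hE _)); right.
Qed.

End DivisibleExtension.

Section RationalsModIntegers.

Definition int_pred : {pred rat} := fun x => `[< exists k : int, x = k%:~R >].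

Lemma int_pred_zmod : zmod_closed int_pred.
Proof.
split=> [|x y /asboolP[k ->] /asboolP[l ->]]; apply/asboolP; first by exists 0.
by exists (k - l); rewrite intrB.
Qed.

HB.instance Definition _ := GRing.isZmodClosed.Build rat int_pred int_pred_zmod.

Definition QmodZ := Quotient.quot int_pred.

HB.instance Definition _ := GRing.Zmodule.on QmodZ.

Lemma QmodZ_pi_eq0 (x : rat) :
  (\pi_QmodZ x = 0 :> QmodZ) <-> exists k : int, x = k%:~R.
Proof.
have <- : \pi_QmodZ 0 = 0 :> QmodZ by exact: raddf0.
split=> [/eqP|h]; last apply/eqP; rewrite -Quotient.idealrBE subr0.
  by move/asboolP.
exact/asboolP.
Qed.

Lemma QmodZ_piMn x n : \pi_QmodZ (x *+ n) = (\pi_QmodZ x : QmodZ) *+ n.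
Proof. exact: raddfMn. Qed.

Lemma QmodZ_divisible n (d : QmodZ) : (0 < n)%N -> exists d', d' *+ n = d.
Proof.
move=> n_gt0; exists (\pi_QmodZ (repr d / n%:R)).
rewrite -QmodZ_piMn -[(_ / _) *+ n]mulr_natr divfK ?reprK //.
by rewrite (Num.Theory.pnatr_eq0 rat n) -lt0n.
Qed.

(** A nonzero element of finite order [n] is detected by [1/n], one of infinite
    order by any nonzero value. *)
Lemma QmodZ_character (B : zmodType) (b : B) : b != 0 ->
  exists h : B -> QmodZ, (forall x y, h (x - y) = h x - h y) /\ h b <> 0.
Proof.
move=> b0.
have [c c0 cE] : exists2 c : QmodZ, c <> 0 &
    forall k : int, b *~ k = 0 -> c *~ k = 0.
  have inv_n0 n : (1 < n)%N -> \pi_QmodZ (n%:R^-1) <> 0 :> QmodZ.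
    move=> n_gt1 /QmodZ_pi_eq0 [k /esym e].
    have n0 : n%:R != 0 :> rat by rewrite Num.Theory.pnatr_eq0 -lt0n ltnW.
    have : k%:~R * n%:R = 1 :> rat by rewrite e mulVf.
    rewrite -[n%:R]/((n%:Z)%:~R) -intrM -[1]/(1%:~R) => /intr_inj.
    move/(congr1 absz); rewrite abszM /= => /eqP; rewrite muln_eq1.
    by case/andP=> _ /eqP n1; rewrite n1 in n_gt1.
  have [[m [m_gt0 bm]]|no] :=
    pselect (exists m : nat, (0 < m)%N /\ b *+ m = 0); last first.
    exists (\pi_QmodZ (2%:R^-1)); first exact: inv_n0.
    move=> k bk; have [->|kn0] := eqVneq k 0; first by rewrite mulr0z.
    case: no; exists `|k|%N; split; first by rewrite absz_gt0.
    by rewrite pmulrn abszEsg mulrC mulrzA bk mul0rz.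
  pose p m := (0 < m)%N && (b *+ m == 0).
  have exp : exists m, p m by exists m; rewrite /p m_gt0 bm eqxx.
  have [n /andP[n_gt0 /eqP bn] nmin] := ex_minnP exp.
  have n_gt1 : (1 < n)%N.
    case: n n_gt0 bn {nmin} => [|[|n]] //= _ e.
    by rewrite mulr1n in e; rewrite e eqxx in b0.
  exists (\pi_QmodZ (n%:R^-1)); first exact: inv_n0.
  move=> k bk.
  have n0' : n%:Z != 0 by rewrite eqz_nat -lt0n.
  have r0 := modz_ge0 k n0'.
  have rlt : (k %% n)%Z < n by rewrite ltz_pmod.
  have br : b *~ (k %% n)%Z = 0.
    by move: bk; rewrite (mulrz_euclid b k n) bn mul0rz add0r.
  have rz : (k %% n)%Z = 0.
    move: br r0 rlt; case: (k %% n)%Z => // r hr _ rlt.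
    have [->//|r_gt0] := posnP r.
    have /nmin : p r by rewrite /p r_gt0; apply/eqP.
    by rewrite leqNgt -ltz_nat rlt.
  rewrite (mulrz_euclid _ k n) rz mulr0z addr0 -QmodZ_piMn.
  rewrite -[_^-1 *+ n]mulr_natr mulVf; last first.
    by rewrite Num.Theory.pnatr_eq0 -lt0n.
  by rewrite (_ : \pi_QmodZ 1 = 0) ?mul0rz //; apply/QmodZ_pi_eq0; exists 1.
pose G x d := exists k : int, x = b *~ k /\ d = c *~ k.
have hG : partial_hom G.
  split; first by exists 0; rewrite !mulr0z.
    by move=> d [k [/esym/cE e ->]].
  move=> _ _ _ _ [k [-> ->]] [l [-> ->]]; exists (k - l).
  by rewrite !mulrzBr.
have [h [hB hE]] := divisible_extension QmodZ_divisible hG.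
exists h; split=> //; rewrite (hE b c) //.
by exists 1; rewrite !mulr1z.
Qed.

End RationalsModIntegers.

Section CoinducedModule.
Variable R : pzRingType.

Definition coind_pred : {pred R -> QmodZ} :=
  fun h => `[< forall x y, h (x - y) = h x - h y >].

Lemma coind_pred_zmod : zmod_closed coind_pred.
Proof.
split=> [|f g /asboolP hf /asboolP hg]; apply/asboolP => x y.
  by rewrite -[RHS]/(0 - 0 : QmodZ) subrr.
rewrite -![(f - g) _]/(f _ - g _) hf hg !opprD !opprK.
by rewrite addrACA.
Qed.

(** Hom_Z (R, Q/Z), the module coinduced from Q/Z. *)
Record coind : Type := Coind
  { coind_val : R -> QmodZ; _ : coind_pred coind_val }.

HB.instance Definition _ := [isSub for coind_val].
HB.instance Definition _ := [Choice of coind by <:].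
HB.instance Definition _ := GRing.SubChoice_isSubZmodule.Build (R -> QmodZ)
  coind_pred coind coind_pred_zmod.

Lemma coind_valB (h : coind) x y :
  coind_val h (x - y) = coind_val h x - coind_val h y.
Proof. by case: h => h /= /asboolP. Qed.

Lemma coind_valD (h : coind) x y :
  coind_val h (x + y) = coind_val h x + coind_val h y.
Proof.
have h0 : coind_val h 0 = 0 by rewrite -(subrr 0) coind_valB subrr.
by rewrite -{1}[y]opprK coind_valB -[- y]sub0r coind_valB h0 sub0r opprK.
Qed.

Fact coind_scale_subproof (a : R) (h : coind) :
  coind_pred (fun s => coind_val h (s * a)).
Proof. by apply/asboolP => x y; rewrite mulrBl coind_valB. Qed.

Definition coind_scale a h := Coind (coind_scale_subproof a h).

Fact coind_scaleA a b h :
  coind_scale a (coind_scale b h) = coind_scale (a * b) h.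
Proof. by apply: val_inj; apply/funext => s /=; rewrite mulrA. Qed.

Fact coind_scale1 : left_id 1 coind_scale.
Proof. by move=> h; apply: val_inj; apply/funext => s /=; rewrite mulr1. Qed.

Fact coind_scaleDr : right_distributive coind_scale +%R.
Proof. by move=> a h k; apply: val_inj; apply/funext => s. Qed.

Fact coind_scaleDl h : {morph coind_scale^~ h : a b / a + b}.
Proof.
by move=> a b; apply: val_inj; apply/funext => s /=; rewrite mulrDr coind_valD.
Qed.

HB.instance Definition _ := GRing.Zmodule_isLmodule.Build R coind
  coind_scaleA coind_scale1 coind_scaleDr coind_scaleDl.

Lemma coind_map (M : lmodType R) (chi : M -> QmodZ) :
  (forall x y, chi (x - y) = chi x - chi y) ->
  exists h : {linear M -> coind}, forall m s, coind_val (h m) s = chi (s *: m).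
Proof.
move=> chiB.
have chiD x y : chi (x + y) = chi x + chi y.
  have h0 : chi 0 = 0 by rewrite -(subrr 0) chiB subrr.
  by rewrite -{1}[y]opprK chiB -[- y]sub0r chiB h0 sub0r opprK.
have p m : coind_pred (fun s => chi (s *: m)).
  by apply/asboolP => x y; rewrite scalerBl chiB.
have [|h hE] := @linear_ex R M coind (fun m => Coind (p m)).
  move=> a x y; apply: val_inj; apply/funext => s /=.
  by rewrite scalerDr chiD scalerA.
by exists h => m s; rewrite hE.
Qed.

(** A linear map into the coinduced module is determined by the character
    obtained by evaluation at 1, and characters extend because Q/Z is
    divisible. *)
Lemma coind_injective : injective_module coind.
Proof.
move=> A B f g fi.
have hG : partial_hom (fun b d => exists a, f a = b /\ d = coind_val (g a) 1).
  split; first by exists 0; rewrite !linear0.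
    by move=> d [a []]; rewrite -{1}(linear0 f) => /fi -> ->; rewrite linear0.
  move=> _ _ _ _ [a [<- ->]] [a' [<- ->]]; exists (a - a').
  by rewrite !linearB.
have [h [hB hE]] := divisible_extension QmodZ_divisible hG.
have [k kE] := coind_map hB; exists k => a /=.
apply: val_inj; apply/funext => s /=.
rewrite kE -linearZ; rewrite (hE _ _ (ex_intro _ (s *: a) (conj erefl erefl))).
by rewrite linearZ /= mul1r.
Qed.

Lemma fct_injective (T : Type) (I : lmodType R) :
  injective_module I -> injective_module (T -> I).
Proof.
move=> hI A B f g fi.
have hT t : exists h : {linear B -> I}, forall a, h (f a) = g a t.
  have [gt gtE] : exists gt : {linear A -> I}, forall a, gt a = g a t.
    by apply: linear_ex => a x y; rewrite linearP.
  by have [h hE] := inj_extend gt hI fi; exists h => a; rewrite hE.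
have [h hE] := choice hT.
have [|k kE] := @linear_ex R B (T -> I) (fun b t => h t b).
  by move=> a x y; apply/funext => t; rewrite linearP.
by exists k => a /=; rewrite kE; apply/funext => t; rewrite hE.
Qed.

(** The product of copies of the coinduced module, one for each character of
    [M]; injectivity of the embedding is [QmodZ_character]. *)
Lemma enough_injectives (M : lmodType R) :
  exists (I : lmodType R) (i : {linear M -> I}),
    injective_module I /\ injective i.
Proof.
pose T := {chi : M -> QmodZ | forall x y, chi (x - y) = chi x - chi y}.
have [h hE] := choice (fun chi : T => coind_map (svalP chi)).
have [|k kE] := @linear_ex R M (T -> coind) (fun m chi => h chi m).
  by move=> a x y; apply/funext => t; rewrite linearP.
exists (T -> coind), k; split; first exact/fct_injective/coind_injective.
apply: injP => m; rewrite kE => e; apply: contrapT => /eqP m0.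
have [chi [chiB]] := QmodZ_character m0; apply.
have := congr1 (fun f => coind_val (f (exist _ chi chiB)) 1) e.
by rewrite hE /= scale1r.
Qed.

Lemma ses_injective (M : lmodType R) :
  exists (I L : lmodType R) (f : {linear M -> I}) (g : {linear I -> L}),
    injective_module I /\ ses f g.
Proof.
have [I [f [hI fi]]] := enough_injectives M.
by have [L [g S]] := ses_of_inj fi; exists I, L, f, g.
Qed.

End CoinducedModule.

(** * Vanishing of Ext and dimension shifting *)

Section Orthogonality.
Variable R : pzRingType.
Implicit Types M T K F L P I G U : lmodType R.

(** The vanishing of Ext^1 (M, T), computed from an injective embedding of [T]:
    a map to the cokernel is a class in Ext^1, which is zero when the map
    lifts. *)
Definition orth M T : Prop :=
  forall I T' (i : {linear T -> I}) (p : {linear I -> T'}),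
    injective_module I -> ses i p ->
    forall f : {linear M -> T'},
      exists h : {linear M -> I}, forall x, p (h x) = f x.

Lemma orth_projective P T : projective P -> orth P T.
Proof.
by move=> hP I T' i p hI [_ _ ps] f; apply: proj_lift => // x; apply: ps.
Qed.

Lemma orth_iso G M T (e : {linear G -> M}) :
  injective e -> surj e -> orth G T -> orth M T.
Proof.
move=> ei es hG I T' i p hI S f.
have [h hE] := hG _ _ _ _ hI S (f \o e).
have [|k kE] := @factor_surj R _ _ _ e h es.
  by move=> x; rewrite -{1}(linear0 e) => /ei ->; rewrite linear0.
by exists k => x; have [y <-] := es x; rewrite kE hE.
Qed.

(** From Ext^1 (K, T) = 0 and Ext^2 (F, T) = Ext^1 (F, T') = 0 the long exact
    sequence gives Ext^2 (L, T) = Ext^1 (L, T') = 0. *)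
Lemma orth_quot K F L T T' I (a : {linear K -> F}) (b : {linear F -> L})
    (i : {linear T -> I}) (p : {linear I -> T'}) :
  ses a b -> injective_module I -> ses i p ->
  orth K T -> orth F T' -> orth L T'.
Proof.
move=> Sab hI Sip oK oF I' T'' j q hI' Sjq f.
have [h hE] := oF _ _ _ _ hI' Sjq (f \o b).
have [x|k kE] := ses_lift Sjq (h := h \o a).
  by rewrite /= hE /= (ses_comp Sab) linear0.
have [k' k'E] := oK _ _ _ _ hI Sip k.
have [ai _ bs] := Sab.
have [e eE] := inj_extend k' hI ai.
have [x|h' h'E] := ses_desc Sab (h := h \- (j \o (p \o e))).
  by rewrite /= eE k'E kE /= subrr.
exists h' => z; have [y <-] := bs z.
by rewrite h'E /= linearB hE /= (ses_comp Sjq) subr0.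
Qed.

(** Ext^2 (L, T) = Ext^1 (K, T), the hypothesis being the vanishing of the left
    side computed from any cosyzygy [T'] of [T]. *)
Lemma orth_syz K P L T (a : {linear K -> P}) (b : {linear P -> L}) :
  ses a b -> projective P ->
  (forall I T' (i : {linear T -> I}) (p : {linear I -> T'}),
     injective_module I -> ses i p -> orth L T') ->
  orth K T.
Proof.
move=> Sab hP oL I T' i p hI Sip f.
have [I' [T'' [j [q [hI' Sjq]]]]] := ses_injective T'.
have [ai _ bs] := Sab.
have [e eE] := inj_extend (j \o f) hI' ai.
have [x|g gE] := ses_desc Sab (h := q \o e).
  by rewrite /= eE /= (ses_comp Sjq).
have [h hE] := oL _ _ _ _ hI Sip _ _ _ _ hI' Sjq g.
have [x|m mE] := ses_lift Sjq (h := e \- (h \o b)).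
  by rewrite /= linearB hE gE /= subrr.
have [_ _ ps] := Sip.
have [n nE] := proj_lift (g := m) hP (fun x => ps _).
exists (n \o a) => x /=; rewrite nE.
have [ji _ _] := Sjq; apply: ji.
by rewrite mE /= (ses_comp Sab) linear0 subr0 eE.
Qed.

Lemma orth_split K P L (a : {linear K -> P}) (b : {linear P -> L}) :
  ses a b -> orth L K ->
  exists r : {linear P -> K}, forall x, r (a x) = x.
Proof.
move=> Sab oL.
have [I [T [i [p [hI Sip]]]]] := ses_injective K.
have [ai _ bs] := Sab; have [e eE] := inj_extend i hI ai.
have [x|g gE] := ses_desc Sab (h := p \o e).
  by rewrite /= eE (ses_comp Sip).
have [h hE] := oL _ _ _ _ hI Sip g.
have [x|r rE] := ses_lift Sip (h := e \- (h \o b)).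
  by rewrite /= linearB hE gE /= subrr.
exists r => x; have [ii _ _] := Sip; apply: ii.
by rewrite rE /= (ses_comp Sab) linear0 subr0 eE.
Qed.

(** A relation rather than a function of [T], since cosyzygies depend on the
    embeddings that are chosen. *)
Fixpoint cosyz n T T' : Prop :=
  if n is m.+1 then
    exists T1 I (i : {linear T1 -> I}) (p : {linear I -> T'}),
      [/\ cosyz m T T1, injective_module I & ses i p]
  else T' = T.

Lemma cosyz_ex n T : exists T', cosyz n T T'.
Proof.
elim: n => [|n [T1 h1]]; first by exists T.
have [I [T' [i [p [hI S]]]]] := ses_injective T1.
by exists T', T1, I, i, p.
Qed.

Lemma cosyz_first n T T' : cosyz n.+1 T T' ->
  exists T1 I (i : {linear T -> I}) (p : {linear I -> T1}),
    [/\ injective_module I, ses i p & cosyz n T1 T'].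
Proof.
elim: n T' => [|n IH] T' [T1 [I [i [p [h hI S]]]]].
  by move: h => /= e; rewrite e in i S; exists T', I, i, p.
have [T0 [J [j [q [hJ SJ h0]]]]] := IH _ h.
by exists T0, J, j, q; split=> //; exists T1, I, i, p.
Qed.

(** All syzygies are required to have the smaller dimension.  This strong form
    makes the syzygy chosen in [pure_orth] admissible, and is what
    [tot_test_pd] yields. *)
Fixpoint pd_le n L : Prop :=
  if n is m.+1 then
    forall K P (a : {linear K -> P}) (b : {linear P -> L}),
      projective P -> ses a b -> pd_le m K
  else projective L.

Lemma resolution_first (C : lmodType R -> Prop) n M :
  resolution_dim_le C n.+1 M ->
  exists K G (a : {linear K -> G}) (b : {linear G -> M}),
    [/\ C G, ses a b & resolution_dim_le C n K].
Proof.
move=> [G [d [e [[ex ex0 es] CG G0]]]].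
have [K [a Sa]] := ses_of_surj es.
have [x|e' e'E] := ses_lift Sa (h := d 0%N).
  by apply/ex0; exists x.
exists K, (G 0%N), a, e; split=> //; first exact: CG.
have [ai _ _] := Sa.
exists (fun i => G i.+1), (fun i => d i.+1), e'; split.
- split=> [i|y|y]; first exact: ex.
    split=> [h|[x <-]].
      by apply/(ex 0%N); rewrite -e'E h linear0.
    apply: ai; rewrite e'E linear0.
    by apply/(ex 0%N); exists x.
  have [x xE] := (ex0 (a y)).1 (ses_comp Sa _).
  by exists x; apply: ai; rewrite e'E.
- by move=> i le; apply: CG.
- by move=> i lt; apply: G0.
Qed.

Lemma resolution_last (C : lmodType R -> Prop) M :
  resolution_dim_le C 0 M ->
  exists G (e : {linear G -> M}), [/\ C G, injective e & surj e].
Proof.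
move=> [G [d [e [[ex ex0 es] CG G0]]]]; exists (G 0%N), e; split=> //.
  exact: CG.
apply: injP => x /ex0 [y <-].
by rewrite (G0 1%N isT y) linear0.
Qed.

End Orthogonality.

(** * Modules tested by totally acyclic complexes *)

Section TotalTests.
Variable R : pzRingType.
Implicit Types M T K F L P I G U : lmodType R.

Lemma Hom_to_exactP (X : int -> lmodType R)
    (d : forall i : int, {linear X (i + 1) -> X i}) L :
  exact_complex d ->
  (forall i (g : {linear X (i + 1) -> L}), (forall x, g (d (i + 1) x) = 0) ->
     exists h : {linear X i -> L}, forall x, h (d i x) = g x) ->
  Hom_to_exact d L.
Proof.
move=> ex H i g; split=> [/H //|[h hE] x] /=.
by rewrite -hE /= (_ : d i _ = 0) ?linear0 //; apply/ex; exists x.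
Qed.

Definition tot_acyclic (X : int -> lmodType R)
    (d : forall i : int, {linear X (i + 1) -> X i}) : Prop :=
  [/\ forall i, projective (X i), exact_complex d
    & forall L, projective L -> Hom_to_exact d L].

(** Over a ring of finite Gorenstein global dimension these are the modules of
    finite projective dimension, equivalently of finite injective dimension. *)
Definition tot_test T : Prop :=
  forall X d, @tot_acyclic X d -> Hom_to_exact d T.

Lemma tot_test_injective I : injective_module I -> tot_test I.
Proof.
move=> hI X d [_ ex _]; apply: Hom_to_exactP => // i g gd.
have [B [j [ji jE]]] := submodule_ex (img_submod (d i)).
have [d' d'E] := factor_inj ji (fun x => (jE (d i x)).1 (ex_intro _ x erefl)).
have d's : surj d'.
  move=> b; have [x xE] := (jE (j b)).2 (ex_intro _ b erefl).
  by exists x; apply: ji; rewrite d'E.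
have [|g' g'E] := @factor_surj R _ _ _ d' g d's.
  by move=> x e; have /ex [y <-] : d i x = 0 by rewrite -d'E e linear0.
have [h hE] := inj_extend g' hI ji.
by exists h => x; rewrite -d'E hE g'E.
Qed.

Lemma tot_test_projective P : projective P -> tot_test P.
Proof. by move=> hP X d [_ _ h]; apply: h. Qed.

Section TwoOutOfThree.
Variables (K F L : lmodType R) (a : {linear K -> F}) (b : {linear F -> L}).
Hypothesis S : ses a b.

(** The short exact sequence of complexes Hom (X, -), exact as the terms of X
    are projective, has two exact members, hence a third. *)
Lemma tot_test_quot : tot_test K -> tot_test F -> tot_test L.
Proof.
move=> hK hF X d hX; have [Xp ex _] := hX.
have {}hK := hK X d hX; have {}hF := hF X d hX.
apply: Hom_to_exactP => // i g gd.
have [ai _ bs] := S.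
have [g' g'E] := proj_lift (g := g) (Xp _) (fun x => bs _).
have [x|k kE] := ses_lift S (h := g' \o d (i + 1)).
  by rewrite /= g'E gd.
have [|h' h'E] := (hK (i + 1) k).1.
  move=> x /=; apply: ai; rewrite kE /= linear0.
  by rewrite (_ : d (i + 1) _ = 0) ?linear0 //; apply/ex; exists x.
have [x|h hE] := (hF i (g' \- (a \o h'))).1.
  by rewrite /= -[h' _]/((h' \o d (i + 1)) x) h'E kE /= subrr.
exists (b \o h) => x /=; rewrite -[h _]/((h \o d i) x) hE /=.
by rewrite linearB g'E (ses_comp S) subr0.
Qed.

Lemma tot_test_sub : tot_test F -> tot_test L -> tot_test K.
Proof.
move=> hF hL X d hX; have [Xp ex _] := hX.
have {}hF := hF X d hX; have {}hL := hL X d hX.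
apply: Hom_to_exactP => // i.
have [j ->] : exists j, i = j + 1 by exists (i - 1); rewrite subrK.
move=> {i} g gd; have [ai _ bs] := S.
have [x|h hE] := (hF (j + 1) (a \o g)).1.
  by rewrite /= gd linear0.
have [x|k kE] := (hL j (b \o h)).1.
  by rewrite /= -[h _]/((h \o d (j + 1)) x) hE /= (ses_comp S).
have [k' k'E] := proj_lift (g := k) (Xp _) (fun x => bs _).
have [x|m mE] := ses_lift S (h := h \- (k' \o d j)).
  by rewrite /= linearB k'E -[k _]/((k \o d j) x) kE /= subrr.
exists m => x; apply: ai; rewrite mE /= (_ : d j _ = 0); last first.
  by apply/ex; exists x.
by rewrite linear0 subr0 -[h _]/((h \o d (j + 1)) x) hE.
Qed.

End TwoOutOfThree.

Lemma tot_test_cosyz n T T' : tot_test T -> cosyz n T T' -> tot_test T'.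
Proof.
move=> hT; elim: n T' => [|n IH] T' /=; first by move=> ->.
move=> [T1 [I [i [p [/IH h1 hI S]]]]].
exact: tot_test_quot S h1 (tot_test_injective hI).
Qed.

(** Maps from a totally acyclic complex to [T] compute Ext^1 of the cokernel. *)
Lemma Gorenstein_projective_orth G T :
  Gorenstein_projective G -> tot_test T -> orth G T.
Proof.
move=> [X [d [Xp ex [q [exq qs]] Xh]]] hT I T' i p hI S f.
have {}hT : Hom_to_exact d T by apply: hT.
have [ii _ ps] := S.
have [h hE] := proj_lift (g := f \o q) (Xp _) (fun x => ps _).
have qd x : q (d 0 x) = 0 by apply/exq; exists x.
have [x|k kE] := ses_lift S (h := h \o d 0).
  by rewrite /= hE /= qd linear0.
have [|l lE] := (hT 0 k).1.
  move=> x /=; apply: ii; rewrite kE /= linear0 (_ : d 0 _ = 0) ?linear0 //.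
  by apply/ex; exists x.
have [|h' h'E] := @factor_surj R _ _ _ q (h \- (i \o l)) qs.
  move=> x /exq [y <-] /=.
  by rewrite -[l _]/((l \o d 0) y) lE kE /= subrr.
exists h' => z; have [x <-] := qs z.
by rewrite h'E /= linearB hE /= (ses_comp S) subr0.
Qed.

(** Ext^(n+1) (M, T) = 0, by dimension shifting along a resolution of [M] by
    Gorenstein projectives, which are orthogonal to [T] and its cosyzygies. *)
Lemma Gpd_orth n M T T' :
  Gpd_le n M -> tot_test T -> cosyz n T T' -> orth M T'.
Proof.
move=> hM hT; elim: n M T' hM => [|n IH] M T'.
  move=> /resolution_last [G [e [hG ei es]]] /= ->.
  exact: orth_iso ei es (Gorenstein_projective_orth hG hT).
move=> /resolution_first [K [G [a [b [hG Sab hK]]]]] hT'.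
have hTT' := tot_test_cosyz hT hT'.
have [T1 [I [i [p [h1 hI S]]]]] := hT'.
apply: (orth_quot Sab hI S); first exact: IH.
exact: Gorenstein_projective_orth.
Qed.

Section FiniteGlobalDimension.
Variable n : nat.
Hypothesis hR : forall M, Gpd_le n M.

(** By [Gpd_orth] the sequence that starts an injective coresolution of [T']
    splits. *)
Lemma tot_test_id T T' : tot_test T -> cosyz n T T' -> injective_module T'.
Proof.
move=> hT hT'.
have [I [T'' [i [p [hI S]]]]] := ses_injective T'.
have [r rE] := orth_split S (Gpd_orth (hR T'') hT hT').
exact: injective_retract rE.
Qed.

(** Let [K] be the n-th syzygy of [L], and [T -> P -> K] the sequence presenting
    it.  This sequence splits, as Ext^1 (K, T) = Ext^(n+1) (L, T) vanishes by
    [Gpd_orth]. *)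
Lemma tot_test_pd L : tot_test L -> pd_le n L.
Proof.
move=> hL; have: forall T T', tot_test T -> cosyz n T T' -> orth L T'.
  by move=> T T'; apply: Gpd_orth (hR L).
elim: n L hL => [|m IH] L hL oL /=.
  have [K [P [a [b [hP S]]]]] := ses_projective L.
  have hK := tot_test_sub S (tot_test_projective hP) hL.
  have [r rE] := orth_split S (oL _ _ hK erefl).
  have [x|s sE] := ses_desc S (h := idfun \- (a \o r)).
    by rewrite /= rE subrr.
  apply: (projective_retract (i := s) (p := b)) => // z.
  have [_ _ bs] := S; have [y <-] := bs z.
  by rewrite sE /= linearB (ses_comp S) subr0.
move=> K P a b hP S; apply: IH.
  exact: tot_test_sub S (tot_test_projective hP) hL.
move=> T T' hT hT'; apply: (orth_syz S hP) => I T'' i p hI Sip.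
by apply: (oL T) => //; exists T', I, i, p.
Qed.

End FiniteGlobalDimension.
End TotalTests.

(** * Periodic classes and Gorenstein AC-injective modules *)

Section PeriodicClasses.
Variable R : pzRingType.
Implicit Types A B C D M T K F L P I J G U : lmodType R.

(** Every member is the first cosyzygy of another member, and the class
    contains the cosyzygies of its members. If Ext^1 (A, -) vanishes on such a
    class, then so do all higher Ext groups, by dimension shifting inside the
    class. *)
Definition periodic_class (CC : lmodType R -> Prop) : Prop :=
  (forall C, CC C -> exists C1 I (i : {linear C1 -> I}) (p : {linear I -> C}),
     [/\ CC C1, injective_module I & ses i p]) /\
  (forall C C' I (i : {linear C -> I}) (p : {linear I -> C'}),
     CC C -> injective_module I -> ses i p -> CC C').

Lemma horseshoe A B C I J A1 C1 (a : {linear A -> B}) (b : {linear B -> C})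
    (i : {linear A -> I}) (p : {linear I -> A1})
    (j : {linear C -> J}) (q : {linear J -> C1}) :
  ses a b -> injective_module I -> ses i p -> ses j q ->
  exists B1 (k : {linear B -> (I * J)%type}) (r : {linear (I * J)%type -> B1})
    (a1 : {linear A1 -> B1}) (b1 : {linear B1 -> C1}), ses k r /\ ses a1 b1.
Proof.
move=> Sab hI Sip Sjq.
have [ai _ bs] := Sab; have [ii _ ps] := Sip; have [ji _ qs] := Sjq.
have [e eE] := inj_extend i hI ai.
have [k kE] := pair_maps e (j \o b).
have ki : injective k.
  apply: injP => x; rewrite kE => -[ex /= /eqP].
  rewrite -(linear0 j) => /eqP /ji /(ses_ker Sab) [y yE].
  move: ex; rewrite -yE eE -(linear0 i) => /ii ->.
  by rewrite linear0.
have [B1 [r Skr]] := ses_of_inj ki.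
have [inl inlE] := pair_maps (idfun : {linear I -> I}) (\0 : {linear I -> J}).
have [x|a1 a1E] := ses_desc Sip (h := r \o inl).
  rewrite /= inlE /= (_ : (_, _) = k (a x)) ?(ses_comp Skr) //.
  by rewrite kE /= eE (ses_comp Sab) linear0.
have [x|b1 b1E] := ses_desc Skr (h := q \o snd).
  by rewrite /= kE /= (ses_comp Sjq).
have [_ _ rs] := Skr.
exists B1, k, r, a1, b1; split=> //; split.
- apply: injP => z; have [x <-] := ps z; rewrite a1E /= inlE /=.
  move=> /(ses_ker Skr) [y]; rewrite kE => -[<- /= /eqP].
  rewrite -(linear0 j) => /eqP /ji /(ses_ker Sab) [w <-].
  by rewrite eE (ses_comp Sip).
- move=> z; split=> [|[w <-]]; last first.
    by have [x <-] := ps w; rewrite a1E /= b1E inlE /= linear0.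
  have [[x y] <-] := rs z; rewrite b1E /= => /(ses_ker Sjq) [c <-].
  have [w <-] := bs c; exists (p (x - e w)).
  rewrite a1E /= inlE /=.
  apply/eqP; rewrite -subr_eq0 -linearB; apply/eqP.
  rewrite (_ : _ - _ = k (- w)) ?(ses_comp Skr) // kE !linearN /=.
  by congr (_, _); rewrite /= ?sub0r // addrAC subrr sub0r.
- move=> z; have [y <-] := qs z; exists (r (0, y)).
  by rewrite b1E.
Qed.

Lemma cosyz_horseshoe n A B C A' C'
    (a : {linear A -> B}) (b : {linear B -> C}) :
  ses a b -> cosyz n A A' -> cosyz n C C' ->
  exists B' (a' : {linear A' -> B'}) (b' : {linear B' -> C'}),
    cosyz n B B' /\ ses a' b'.
Proof.
move=> Sab; elim: n A' C' => [|n IH] A' C'.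
  by move=> /= -> ->; exists B, a, b.
move=> [A1 [I [i [p [hA hI Sip]]]]] [C1 [J [j [q [hC hJ Sjq]]]]].
have [B1 [a1 [b1 [hB S1]]]] := IH _ _ hA hC.
have [B' [k [r [a' [b' [Skr S']]]]]] := horseshoe S1 hI Sip Sjq.
exists B', a', b'; split=> //; exists B1, (I * J)%type, k, r; split=> //.
exact: pair_injective.
Qed.

Definition cosyz_class n C : Prop := exists M, cosyz n M C.

(** The horseshoe lemma on [K -> P -> M], with [P] projective, presents the
    n-th cosyzygy of [M] as a quotient of the n-th cosyzygy of [P], which is
    injective, with kernel the n-th cosyzygy of [K]. *)
Lemma cosyz_class_periodic n :
  (forall P P', projective P -> cosyz n P P' -> injective_module P') ->
  periodic_class (cosyz_class n).
Proof.
move=> hn; split=> [C [M hC]|C C' I i p [M hC] hI S].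
  have [K [P [a [b [hP Sab]]]]] := ses_projective M.
  have [C1 hC1] := cosyz_ex n K.
  have [P' [a' [b' [hP' S']]]] := cosyz_horseshoe Sab hC1 hC.
  exists C1, P', a', b'; split=> //; first by exists K.
  exact: hn hP hP'.
have h : cosyz n.+1 M C' by exists C, I, i, p.
by have [M1 [J [j [q [_ _ h1]]]]] := cosyz_first h; exists M1.
Qed.

Lemma injective_orth A I : injective_module I -> orth A I.
Proof.
move=> hI J T j q hJ S f.
have [ji _ qs] := S; have [r rE] := inj_extend (idfun : {linear I -> I}) hI ji.
have [x|s sE] := ses_desc S (h := idfun \- (j \o r)).
  by rewrite /= rE /= subrr.
exists (s \o f) => x /=; have [y <-] := qs (f x).
by rewrite sE /= linearB /= (ses_comp S) subr0.
Qed.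

Lemma injective_class_periodic : periodic_class (@injective_module R).
Proof.
split=> [I hI|I C' J j q hI hJ S].
  have [i iE] := pair_maps (idfun : {linear I -> I}) (\0 : {linear I -> I}).
  exists I, (I * I)%type, i, snd; split=> //; first exact: pair_injective.
  split=> [x y|[x y]|y]; first by rewrite !iE => -[].
    split=> [/= ->|[z]]; first by exists x; rewrite iE.
    by rewrite iE => -[_ <-].
  by exists (0, y).
have [h hE] := @injective_orth C' I hI _ _ _ _ hJ S idfun.
exact: injective_retract hJ hE.
Qed.

(** Splicing: every member of a periodic class is a cycle of an acyclic complex
    of injectives all of whose cycles belong to the class. *)
Lemma periodic_Gorenstein_AC_injective (CC : lmodType R -> Prop) C :
  periodic_class CC ->
  (forall A C', absolutely_clean A -> CC C' -> orth A C') ->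
  CC C -> Gorenstein_AC_injective C.
Proof.
move=> [left_step right_step] oCC hC.
pose Cyc := {D | CC D}.
pose link (z' z : Cyc) :=
  exists I (i : {linear sval z' -> I}) (p : {linear I -> sval z}),
    injective_module I /\ ses i p.
have lex (z : Cyc) : exists z' : Cyc, link z' z.
  case: z => D hD.
  have [D1 [I [i [p [hD1 hI S]]]]] := left_step D hD.
  by exists (exist _ D1 hD1), I, i, p.
have [lft lftE] := choice lex.
have rex (z : Cyc) : exists z' : Cyc, link z z'.
  case: z => D hD.
  have [I [D1 [i [p [hI S]]]]] := ses_injective D.
  by exists (exist _ D1 (right_step _ _ _ _ _ hD hI S)), I, i, p.
have [rgt rgtE] := choice rex.
(* Kernels to the left of [C] stay in the class by periodicity, cokernels to the
   right by closure under cosyzygies. *)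
pose z0 : Cyc := exist _ C hC.
pose Z (i : int) := match i with
  | Posz n => iter n lft z0 | Negz n => iter n.+1 rgt z0 end.
have H i : link (Z (i + 1)) (Z i).
  case: i => [n|[|n]].
  - by rewrite -PoszD addn1; apply: lftE.
  - by apply: rgtE.
  - have -> : Negz n.+1 + 1 = Negz n.
      by rewrite !NegzE -addn1 PoszD opprD addrNK.
    by apply: rgtE.
pose X i := sval (cid (H i)).
have HX i := svalP (cid (H i)).
pose f i := sval (cid (HX i)).
have Hf i := svalP (cid (HX i)).
pose g i := sval (cid (Hf i)).
have Hg i : injective_module (X i) /\ ses (f i) (g i) := svalP (cid (Hf i)).
pose d i : {linear X (i + 1) -> X i} := f i \o g (i + 1).
have dE i x : d i x = f i (g (i + 1) x) by [].
have d0 i x : d i x = 0 <-> g (i + 1) x = 0.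
  have [_ [fi _ _]] := Hg i; split=> [|h]; last by rewrite dE h linear0.
  by rewrite dE -{1}(linear0 (f i)) => /fi.
have exact_g i : exact_at (d i) (g i).
  have [_ S] := Hg i; have [_ [_ _ gs]] := Hg (i + 1) => x.
  split=> [/(ses_ker S) [z <-]|[y <-]]; last exact: ses_comp S _.
  by have [y <-] := gs z; exists y.
exists X, d; split.
- by move=> i; case: (Hg i).
- by move=> i x; rewrite d0; apply: exact_g.
- exists (g 0); split; first exact: exact_g.
  by have [_ []] := Hg 0.
- move=> A hA i h; split=> [dh|[k kE] x]; last first.
    by rewrite /= -kE /=; apply/d0/exact_g; eexists.
  have [_ S] := Hg (i + 1); have [hI S'] := Hg (i + 1 + 1).
  have [x|h' h'E] := ses_lift S (h := h); first by apply/d0/dh.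
  have [k kE] := oCC A _ hA (svalP (Z (i + 1 + 1 + 1))) _ _ _ _ hI S' h'.
  by exists k => x /=; rewrite kE h'E.
Qed.

Lemma injective_Gorenstein_AC_injective I :
  injective_module I -> Gorenstein_AC_injective I.
Proof.
apply: periodic_Gorenstein_AC_injective injective_class_periodic _.
by move=> A C' _; apply: injective_orth.
Qed.

Lemma coresolution_zero (D : lmodType R -> Prop) M :
  D M -> coresolution_dim_le D 0 M.
Proof.
move=> hM; pose G i : lmodType R := if i is 0%N then M else 'rV[R]_0.
have z i (x : G i.+1) : x = 0 by apply: thinmx0.
exists G, (fun i => \0), (idfun : {linear M -> G 0%N}); split.
- split=> [x y //|y]; split=> // _.
  by exists y.
- move=> i x; split=> // _; exists 0; rewrite linear0.
  by rewrite [RHS]z.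
- by case.
- by case=> // i _ x; apply: z.
Qed.

Lemma coresolution_cons (D : lmodType R -> Prop) n M M' I
    (i : {linear M -> I}) (p : {linear I -> M'}) :
  ses i p -> D I -> coresolution_dim_le D n M' ->
  coresolution_dim_le D n.+1 M.
Proof.
move=> S hI [G [d [e [[ei ex0] ex hG G0]]]].
pose G' k : lmodType R := if k is j.+1 then G j else I.
pose d' k : {linear G' k -> G' k.+1} :=
  match k return {linear G' k -> G' k.+1} with
  | 0%N => (e \o p : {linear I -> G 0%N}) | j.+1 => d j end.
have [ii _ ps] := S.
exists G', d', (i : {linear M -> G' 0%N}); split.
- split=> // y; split=> [/=|[x <-]] /=; last by rewrite (ses_comp S) linear0.
  by rewrite -(linear0 e) => /ei /(ses_ker S).
- case=> [|k] //= y; split=> [/ex0 [m <-]|[x <-]] /=.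
    by have [x <-] := ps m; exists x.
  by apply/ex0; eexists.
- by case=> [|k] //= le; apply: hG.
- by case=> [|k] //= lt; apply: G0.
Qed.

Lemma cosyz_coresolution (D : lmodType R -> Prop) n M C :
  (forall I, injective_module I -> D I) -> D C -> cosyz n M C ->
  coresolution_dim_le D n M.
Proof.
move=> hD hC; elim: n M => [|n IH] M.
  by move=> /= e; rewrite -e; apply: coresolution_zero.
move=> /cosyz_first [M1 [I [i [p [hI S h]]]]].
exact: coresolution_cons S (hD _ hI) (IH _ h).
Qed.

End PeriodicClasses.

(** * Filtrations and directed unions *)

Section WellOrder.

Lemma well_order_ex (T : eqType) : exists le : T -> T -> Prop,
  [/\ forall x y, le x y \/ le y x,
      forall x y, le x y -> le y x -> x = y,
      forall x y z, le x y -> le y z -> le x z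
    & forall A : T -> Prop, (exists x, A x) ->
        exists2 x, A x & forall y, A y -> le x y].
Proof.
have [le wo] := well_ordering_principle T.
have min (A : T -> Prop) : (exists x, A x) ->
    exists2 x, A x & forall y, A y -> le x y.
  move=> [x Ax]; have [|z [[Az zmin] _]] := wo (fun x => `[< A x >]).
    by exists x; apply/asboolP.
  by exists z => [|y Ay]; [apply/asboolP | apply/zmin/asboolP].
have tot x y : le x y \/ le y x.
  have [|z [->|->] zmin] := min (fun z => z = x \/ z = y).
  - by exists x; left.
  - by left; apply: zmin; right.
  - by right; apply: zmin; left.
have refl x : le x x by case: (tot x x).
have anti x y : le x y -> le y x -> x = y.
  move=> xy yx; have [|z [_ zu]] := wo (fun z => (z == x) || (z == y)).
    by exists x; rewrite /in_mem /= eqxx.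
  have mx : minimum_of le (fun z => (z == x) || (z == y)) x.
    split; first by rewrite /in_mem /= eqxx.
    by move=> u; rewrite /in_mem /= => /orP[] /eqP ->.
  have my : minimum_of le (fun z => (z == x) || (z == y)) y.
    split; first by rewrite /in_mem /= eqxx orbT.
    by move=> u; rewrite /in_mem /= => /orP[] /eqP ->.
  by rewrite -(zu _ mx) (zu _ my).
exists le; split=> // x y z xy yz.
have [|m hm mmin] := min (fun u => [\/ u = x, u = y | u = z]).
  by exists x; constructor 1.
have mx : le m x by apply: mmin; constructor 1.
have my : le m y by apply: mmin; constructor 2.
have mz : le m z by apply: mmin; constructor 3.
case: hm => e; rewrite e in mx my mz => //.
- by rewrite (anti x y xy mx).
- by rewrite -(anti y z yz my).
Qed.

End WellOrder.

Section MonotoneBounds.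
Variables (I : choiceType) (r : I -> I -> Prop) (i0 : I).
Hypotheses (rxx : forall x, r x x)
  (rtrans : forall x y z, r x y -> r y z -> r x z)
  (rdir : forall x y, exists z, r x z /\ r y z).
Local Open Scope fset_scope.

(** Upper bounds of finite sets can be chosen monotonically in a directed
    preorder because a finite set has only finitely many subsets: by recursion
    on the size, the bound of a set is taken above those of its subsets. *)
Lemma monotone_bounds : exists phi : {fset I} -> I,
  (forall A B : {fset I}, A `<=` B -> r (phi A) (phi B)) /\
  forall (A : {fset I}) a, a \in A -> r a (phi A).
Proof.
have ubex (s : seq I) : exists z, forall x, x \in s -> r x z.
  elim: s => [|x s [z hz]]; first by exists i0.
  have [w [xw zw]] := rdir x z; exists w => y.
  by rewrite inE => /predU1P[->//|/hz yz]; apply: rtrans zw.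
have [ub ubE] := choice ubex.
(* The subsets of [A] include [A], so that the values grow with the fuel. *)
pose fix phi (n : nat) (A : {fset I}) {struct n} : I :=
  if n is m.+1 then ub ([seq phi m B | B <- fpowerset A] ++ A) else i0.
have sub n (A B : {fset I}) : B `<=` A -> r (phi n B) (phi n.+1 A).
  move=> BA; apply: ubE; rewrite mem_cat; apply/orP; left.
  by apply/mapP; exists B => //; rewrite fpowersetE.
have grow n m A : (n <= m)%N -> r (phi n A) (phi m A).
  move=> /subnKC <-; elim: (m - n)%N => [|k IH]; first by rewrite addn0.
  by rewrite addnS; apply: rtrans IH (sub _ _ _ (fsubset_refl A)).
exists (fun A => phi #|` A|.+1 A); split=> [A B AB|A a aA]; last first.
  by apply: ubE; rewrite mem_cat aA orbT.
have [->//|ne] := eqVneq A B.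
have lt : (#|` A| < #|` B|)%N.
  by apply: fproper_ltn_card; rewrite fproperEneq ne.
apply: rtrans (grow _ _ A lt) _; exact: sub.
Qed.

End MonotoneBounds.

Section RelativeOrthogonality.
Variable R : pzRingType.
Implicit Types M T K F L P I J : lmodType R.

Lemma graph_extend (Phi I : lmodType R) (G : Phi -> I -> Prop) :
  injective_module I -> G 0 0 -> (forall y, G 0 y -> y = 0) ->
  (forall a x y x' y', G x y -> G x' y' -> G (a *: x + x') (a *: y + y')) ->
  exists h : {linear Phi -> I}, forall x y, G x y -> h x = y.
Proof.
move=> hI G0 fn lin.
have dom : submod (fun x => exists y, G x y).
  split=> [|a x x' [y h] [y' h']]; first by exists 0.
  by exists (a *: y + y'); apply: lin.
have [W [i [ii iE]]] := submodule_ex dom.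
have [|||f fE] := @linear_of_rel R W I (fun w y => G (i w) y).
- by move=> w; apply/iE; exists w.
- by rewrite linear0.
- by move=> a x y x' y'; rewrite linearP; apply: lin.
have [h hE] := inj_extend f hI ii.
exists h => x y hxy; have [w wE] := (iE x).1 (ex_intro _ y hxy).
rewrite -wE hE; apply/eqP; rewrite -subr_eq0; apply/eqP/fn.
have := lin (-1) _ _ _ _ hxy (fE w).
by rewrite wE !scaleN1r addNr [- y + _]addrC.
Qed.

Section Ambient.
Variable Phi : lmodType R.
Implicit Types (V N : Phi -> Prop).

(** Ext^1 (V / N, T) = 0, for submodules [N] of [V]: the maps [T -> I -> J]
    begin an injective coresolution, and [g] is a cocycle on [V / N].  Cochains
    are defined on the ambient module [Phi], which is no restriction as their
    targets are injective. *)
Definition relorth T V N : Prop :=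
  forall I J (i : {linear T -> I}) (d : {linear I -> J}),
    injective_module I -> injective_module J -> injective i -> exact_at i d ->
    forall g : {linear Phi -> J},
      (forall x, N x -> g x = 0) -> (forall x, V x -> exists y, d y = g x) ->
      exists h : {linear Phi -> I},
        (forall x, N x -> h x = 0) /\ forall x, V x -> d (h x) = g x.

Definition zero_sub : Phi -> Prop := fun x => x = 0.

Section Class.
Variable CC : lmodType R -> Prop.
Hypothesis hCC : periodic_class CC.

Definition left_orth V : Prop := forall T, CC T -> relorth T V zero_sub.

(** A cocycle [g] on [V] that vanishes on [N] is the boundary of some [h] on
    [V]. On [N] this [h] is itself a cocycle, one degree lower, hence the
    boundary of some [h1] there; subtracting the boundary of an extension of
    [h1] makes [h] vanish on [N]. The lower degree is available as [T] is a
    cosyzygy of a member of the class. *)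
Lemma relorth_thick V N : (forall x, N x -> V x) ->
  left_orth V -> left_orth N -> forall T, CC T -> relorth T V N.
Proof.
move=> NV hV hN T hT I J i d hI hJ ii ex g gN gV.
have [h [_ hE]] : exists h : {linear Phi -> I},
    (forall x, zero_sub x -> h x = 0) /\ forall x, V x -> d (h x) = g x.
  by apply: (hV T hT _ _ i) => // x ->; rewrite linear0.
have [T1 [I1 [i1 [p1 [hT1 hI1 S]]]]] := hCC.1 T hT.
have [i1i _ p1s] := S.
have ex1 : exact_at i1 (i \o p1).
  move=> x /=; split=> [|[y <-]]; last by rewrite (ses_comp S) linear0.
  by rewrite -(linear0 i) => /ii /(ses_ker S).
have [h1 [_ h1E]] : exists h1 : {linear Phi -> I1},
    (forall x, zero_sub x -> h1 x = 0) /\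
    forall x, N x -> (i \o p1) (h1 x) = h x.
  apply: (hN T1 hT1 _ _ i1 (i \o p1)) => // [x ->|x Nx].
    by rewrite linear0.
  have /ex [t tE] : d (h x) = 0 by rewrite hE ?gN //; apply: NV.
  by have [y yE] := p1s t; exists y; rewrite /= yE.
exists (h \- ((i \o p1) \o h1)); split=> x hx /=.
  by rewrite -[i _]/((i \o p1) (h1 x)) h1E ?subrr.
rewrite linearB hE // (_ : d (i _) = 0) ?subr0 //.
by apply/ex; eexists.
Qed.

Section Filtration.
Variables (X : eqType) (le : X -> X -> Prop).
Hypotheses (tot : forall x y, le x y \/ le y x)
  (anti : forall x y, le x y -> le y x -> x = y)
  (trans : forall x y z, le x y -> le y z -> le x z)
  (min : forall A : X -> Prop, (exists x, A x) ->
        exists2 x, A x & forall y, A y -> le x y).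

(** Eklof's lemma.  Zorn's lemma is applied to partial solutions whose domain is
    a union of steps [W b]; at the first step missing from the domain, the
    vanishing for the successive quotient extends the solution. *)
Lemma filtration_orth T (D : X -> Prop) (W : X -> Phi -> Prop) N0 :
  (forall x y, D y -> ~ le y x -> D x) ->
  submod N0 -> (forall x, submod (W x)) ->
  (forall x v, N0 v -> W x v) ->
  (forall x y v, le x y -> W x v -> W y v) ->
  relorth T N0 zero_sub ->
  (forall x, D x ->
     relorth T (W x) (fun v => N0 v \/ exists2 y, ~ le x y & W y v)) ->
  relorth T (fun v => N0 v \/ exists2 x, D x & W x v) zero_sub.
Proof.
move=> Ddown sN0 sW N0W Wmono hN0 hW I J i d hI hJ ii ex g _ gV.
have [h0 [_ h0E]] : exists h0 : {linear Phi -> I},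
    (forall x, zero_sub x -> h0 x = 0) /\ forall x, N0 x -> d (h0 x) = g x.
  apply: (hN0 _ _ i) => // [x ->|x hx]; first by rewrite linear0.
  by apply: gV; left.
pose gr (G : set (Phi * I)) x y := G (x, y) \/ N0 x /\ y = h0 x.
pose dom G x := exists y, gr G x y.
pose ok : set (set (Phi * I)) := fun G =>
  [/\ forall y, gr G 0 y -> y = 0,
      forall a x y x' y', gr G x y -> gr G x' y' ->
        gr G (a *: x + x') (a *: y + y'),
      forall x y, gr G x y -> d y = g x
    & forall x, dom G x ->
        N0 x \/ exists b, [/\ D b, W b x & forall v, W b v -> dom G v]].
have N0lin a x y x' y' : N0 x /\ y = h0 x -> N0 x' /\ y' = h0 x' ->
    N0 (a *: x + x') /\ a *: y + y' = h0 (a *: x + x').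
  by move=> [hx ->] [hx' ->]; rewrite linearP; split=> //; apply: sN0.2.
have chain (F : set (set (Phi * I))) :
    (F `<=` ok)%classic -> total_on F classical_sets.subset ->
    ok (bigcup F id).
  move=> Fok Ftot.
  have up G x y : F G -> gr G x y -> gr (bigcup F id) x y.
    by move=> FG [h|h]; [left; exists G | right].
  have two x y x' y' : gr (bigcup F id) x y -> gr (bigcup F id) x' y' ->
      (exists2 G, F G & gr G x y /\ gr G x' y') \/
      (N0 x /\ y = h0 x) /\ (N0 x' /\ y' = h0 x').
    move=> [[G FG hG]|hG] [[H FH hH]|hH]; last by right.
    - left; have [GH|HG] := Ftot _ _ FG FH.
        by exists H => //; split; left => //; apply: GH.
      by exists G => //; split; left => //; apply: HG.
    - by left; exists G => //; split; [left | right].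
    - by left; exists H => //; split; [right | left].
  split=> [y hy|a x y x' y' hx hx'|x y hx|x [y hx]].
  - have [[G FG [h _]]|[[_ ->] _]] := two _ _ _ _ hy hy; last first.
      by rewrite linear0.
    by have [fn _ _ _] := Fok _ FG; apply: fn.
  - have [[G FG [h h']]|[h h']] := two _ _ _ _ hx hx'.
      by apply: (up G) => //; have [_ lin _ _] := Fok _ FG; apply: lin.
    by right; apply: N0lin.
  - have [[G FG [h _]]|[[h ->] _]] := two _ _ _ _ hx hx; last exact: h0E.
    by have [_ _ sol _] := Fok _ FG; apply: sol.
  - have [[G FG [h _]]|[[h _] _]] := two _ _ _ _ hx hx; last by left.
    have [_ _ _ un] := Fok _ FG.
    have [|[b [Db Wb hb]]] := un x (ex_intro _ y h); first by left.
    right; exists b; split=> // v /hb [z hz].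
    by exists z; apply: (up G).
have [G [[fn lin sol un] maxG]] := Zorn_bigcup chain.
have [h hE] : exists h : {linear Phi -> I}, forall x y, gr G x y -> h x = y.
  apply: graph_extend => //; right; split; first exact: submod0.
  by rewrite linear0.
have all b : D b -> forall v, W b v -> dom G v.
  apply: contrapT => nall.
  have [|c [Dc nc] cmin] :=
      min (A := fun b => D b /\ ~ forall v, W b v -> dom G v).
    apply: contrapT => no; apply: nall => Db; apply: contrapT => nb.
    by apply: no; exists b.
  have below y : ~ le c y -> forall v, W y v -> dom G v.
    move=> yc; apply: contrapT => ny; apply: (yc); apply: cmin.
    by split=> //; apply: Ddown Dc yc.
  have domE v : dom G v <-> N0 v \/ exists2 y, ~ le c y & W y v.
    split=> [/un [hv|[y [Dy Wy hy]]]|[hv|[y yc Wy]]].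
    - by left.
    - right; exists y => // cy; apply: nc => u Wu; apply: hy.
      exact: Wmono cy Wu.
    - by exists (h0 v); right.
    - exact: below Wy.
  have hsol v : dom G v -> d (h v) = g v.
    by move=> [y hy]; rewrite (hE _ _ hy); apply: sol.
  have [||k [k0 kE]] := hW c Dc _ _ i d hI hJ ii ex (g \- (d \o h)).
  - by move=> v /domE hv; rewrite /= hsol ?subrr.
  - move=> v Wv; have [|y yE] := gV v; first by right; exists c.
    by exists (y - h v); rewrite linearB yE.
  have Gin v y : gr G v y -> W c v /\ y = (h \+ k) v.
    move=> hv; have /domE dv : dom G v by exists y.
    rewrite /= k0 // addr0 (hE _ _ hv); split=> //.
    case: dv => [/N0W //|[z zc Wz]]; apply: Wmono Wz.
    by case: (tot z c) => // /zc.
  pose H : set (Phi * I) := fun z => W c z.1 /\ z.2 = (h \+ k) z.1.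
  have HE v y : gr H v y <-> W c v /\ y = (h \+ k) v.
    split=> [[//|[Nv ->]]|hv]; last by left.
    by apply: Gin; right.
  apply: (maxG H).
    split=> [[v y] hv|HG]; first by apply: Gin; left.
    by apply: nc => v Wv; exists ((h \+ k) v); left; apply: HG.
  split=> [y /HE [_ ->]|a x y x' y' /HE [hx ->] /HE [hx' ->]|x y /HE [hx ->]|
           x [y /HE [hx _]]].
  - by rewrite linear0.
  - by apply/HE; rewrite linearP; split=> //; apply: (sW c).2.
  - by rewrite /= linearD kE //= addrC subrK.
  - right; exists c; split=> // v Wv; exists ((h \+ k) v); exact/HE.
exists h; split=> [x ->|x hx]; first by rewrite linear0.
have [y hy] : dom G x.
  case: hx => [hx|[b Db Wb]]; first by exists (h0 x); right.
  exact: all Wb.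
by rewrite (hE _ _ hy); apply: sol.
Qed.

End Filtration.

Section DirectedUnion.
Variables (X : choiceType) (V : X -> Phi -> Prop) (x0 : X).
Hypotheses (sV : forall x, submod (V x))
  (dirV : forall x y, exists z,
     (forall v, V x v -> V z v) /\ (forall v, V y v -> V z v))
  (oV : forall x, left_orth (V x)).

Local Open Scope fset_scope.

(** A directed union is reduced to well-ordered filtrations without any
    induction on cardinals. Index the union by the finite subsets of [X],
    using [monotone_bounds], well-order [X], and let [U D B] be the union over
    the finite sets [A `|` B] with [A] contained in [D]. For an initial
    segment [D], splitting off the maximum [x] of [A] shows that [U D B] is
    the union of the chain of the [U (< x) (x |` B)], whose part below [x] is
    [U (< x) B]. Both of these lie over the smaller segment below [x], so that
    by induction they are orthogonal, and so are their quotients, by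
    [relorth_thick]. *)
Lemma directed_union_orth : left_orth (fun v => exists x, V x v).
Proof.
have [|||phi [phi_mono phi_mem]] :=
  @monotone_bounds X (fun x y => forall v, V x v -> V y v) x0.
- by [].
- by move=> x y z h h' v /h /h'.
- exact: dirV.
have [le [tot anti trans min]] := well_order_ex X.
have refl x : le x x by case: (tot x x).
pose U (D : X -> Prop) (B : {fset X}) v :=
  exists2 A : {fset X}, (forall a, a \in A -> D a) & V (phi (A `|` B)) v.
have sU D B : submod (U D B).
  split=> [|a v w [A hA hv] [A' hA' hw]].
    by exists fset0 => //; apply: submod0.
  exists (A `|` A') => [b /fsetUP[/hA|/hA'] //|].
  apply: (sV _).2.
    by apply: phi_mono hv; apply: fsetSU; apply: fsubsetUl.
  by apply: phi_mono hw; apply: fsetSU; apply: fsubsetUr.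
pose lt y x := ~ le x y.
have ltW x y z : lt x y -> le y z -> lt x z.
  by move=> xy yz zx; apply: xy; apply: trans yz zx.
have maxA (A : {fset X}) : A != fset0 ->
    exists2 m, m \in A & forall a, a \in A -> le a m.
  have : forall s : seq X, s != [::] ->
      exists2 m, m \in s & forall a, a \in s -> le a m.
    elim=> // x [|y s] IH _.
      by exists x => [|a]; rewrite inE // => /eqP ->.
    have [//|m ms hm] := IH.
    have [xm|mx] := tot x m.
      exists m; first by rewrite inE ms orbT.
      by move=> a; rewrite inE => /predU1P[->|/hm].
    exists x; first exact: mem_head.
    by move=> a; rewrite inE => /predU1P[->//|/hm am]; apply: trans am mx.
  move=> h /fset0Pn [a aA]; apply: h.
  by apply/eqP => e; have : a \in (A : seq X) by []; rewrite e.
have dec D B : (forall x y, D y -> lt x y -> D x) ->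
    U D B = (fun v => V (phi B) v \/
      exists2 x, D x & U (lt^~ x) (x |` B) v).
  move=> Ddown; apply/funext => v; apply/propext; split.
    move=> [A hA hv]; have [e|/maxA [m mA hm]] := eqVneq A fset0.
      by left; rewrite e fset0U in hv.
    right; exists m; first exact: hA.
    exists (A `\ m); last by rewrite fsetUA [A `\ m `|` _]fsetUC fsetD1K.
    move=> a; rewrite !inE => /andP[ne aA] ma.
    by case/eqP: ne; apply: anti => //; apply: hm.
  case=> [hv|[x Dx [A hA hv]]]; first by exists fset0; rewrite ?fset0U.
  exists (x |` A); last by rewrite -fsetUA fsetUCA.
  move=> a /fset1UP[->//|/hA]; exact: Ddown.
have step D : (forall x y, D y -> lt x y -> D x) ->
    (forall x B, D x -> left_orth (U (lt^~ x) B)) ->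
    forall B, left_orth (U D B).
  move=> Ddown IH B T hT; rewrite dec //.
  have down x y z : lt y x -> lt z y -> lt z x.
    move=> yx zy; apply: ltW zy _; case: (tot y x) => // xy; case: (yx xy).
  apply: (filtration_orth tot min (W := fun x => U (lt^~ x) (x |` B))) => //.
  - move=> x v hv; exists fset0 => //; rewrite fset0U; apply: phi_mono hv.
    exact: fsubsetUr.
  - move=> x y v xy [A hA hv]; have [<-|ne] := eqVneq x y; first by exists A.
    exists (x |` A) => [a /fset1UP[->|/hA ax]|].
    + by move=> yx; case/eqP: ne; apply: anti.
    + exact: ltW ax xy.
    apply: phi_mono hv; rewrite -fsetUA fsetUCA.
    exact/fsetUS/fsetUS/fsubsetUr.
  - exact: oV.
  - move=> x Dx; rewrite -(dec (lt^~ x) B); last by move=> y z; apply: down.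
    apply: relorth_thick => //; last 2 first.
    + exact: IH.
    + exact: IH.
    move=> v [A hA hv]; exists A => //; apply: phi_mono hv.
    exact/fsetUS/fsubsetUr.
have all x B : left_orth (U (lt^~ x) B).
  apply: contrapT => nx.
  have [|c nc cmin] := min (fun x => exists B, ~ left_orth (U (lt^~ x) B)).
    by exists x, B.
  case: nc => C; apply; apply: step => [y z|y E yc].
    by move=> zc yz; apply: ltW yz _; case: (tot z c) => // /zc.
  by apply: contrapT => ny; apply: yc; apply: cmin; exists E.
have -> : (fun v => exists x, V x v) = U (fun=> True) fset0.
  apply/funext => v; apply/propext; split=> [[x hv]|[A _ hv]].
    exists [fset x] => //; rewrite fsetU0; apply: phi_mem hv.
    exact: fset11.
  by exists (phi (A `|` fset0)).
by apply: step.
Qed.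

End DirectedUnion.

Lemma projective_left_orth P (j : {linear P -> Phi}) :
  projective P -> injective j -> left_orth (fun v => exists x, j x = v).
Proof.
move=> hP ji T _ I J i d hI _ _ _ g _ gV.
have [h hE] := proj_lift (f := d) (g := g \o j) hP
  (fun x => gV _ (ex_intro _ x erefl)).
have [k kE] := inj_extend h hI ji.
exists k; split=> [x ->|_ [x <-]]; first by rewrite linear0.
by rewrite kE hE.
Qed.

Lemma left_orth_orth N (W : lmodType R) (w : {linear W -> Phi}) T :
  injective w -> (forall v, N v <-> exists x, w x = v) ->
  left_orth N -> CC T -> orth W T.
Proof.
move=> wi NE oN hT I T' i p hI S f.
have [J [k [hJ ki]]] := enough_injectives T'.
have [ii _ ps] := S.
have ex : exact_at i (k \o p).
  move=> x /=; split=> [|[y <-]]; last by rewrite (ses_comp S) linear0.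
  by rewrite -(linear0 k) => /ki /(ses_ker S).
have [g gE] := inj_extend (k \o f) hJ wi.
have [||h [_ hE]] := oN T hT _ _ i (k \o p) hI hJ ii ex g.
- by move=> x ->; rewrite linear0.
- move=> v /NE [x <-]; have [y yE] := ps (f x).
  by exists y; rewrite gE /= yE.
exists (h \o w) => x; apply: ki.
have /= -> := hE (w x) ((NE _).2 (ex_intro _ x erefl)).
by rewrite gE.
Qed.

End Class.
End Ambient.

Lemma orth_class_quot (CC : lmodType R -> Prop) K F L
    (a : {linear K -> F}) (b : {linear F -> L}) :
  periodic_class CC -> ses a b ->
  (forall T, CC T -> orth K T) -> (forall T, CC T -> orth F T) ->
  forall T, CC T -> orth L T.
Proof.
move=> hCC S oK oF T hT.
have [T1 [I [i [p [hT1 hI Sip]]]]] := hCC.1 T hT.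
exact: orth_quot S hI Sip (oK _ hT1) (oF _ hT).
Qed.
End RelativeOrthogonality.

(** * Flat modules are orthogonal to periodic classes *)

Section Flatness.
Variable R : pzRingType.
Implicit Types M T K F L P I J : lmodType R.

Definition mact L p k (r : 'M[R]_(p, k)) (x : 'I_k -> L) (i : 'I_p) : L :=
  \sum_j r i j *: x j.

Lemma mact_mul L p k m (r : 'M[R]_(p, k)) (c : 'M[R]_(k, m)) (y : 'I_m -> L) i :
  mact (r *m c) y i = mact r (mact c y) i.
Proof.
rewrite /mact; under [RHS]eq_bigr do rewrite scaler_sumr.
rewrite exchange_big /=; apply: eq_bigr => l _.
by rewrite mxE scaler_suml; apply: eq_bigr => j _; rewrite scalerA.
Qed.

Lemma mact_linear L M p k (r : 'M[R]_(p, k)) (f : {linear L -> M}) x i :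
  f (mact r x i) = mact r (f \o x) i.
Proof. by rewrite linear_sum; apply: eq_bigr => j _; rewrite linearZ. Qed.

Lemma eq_mact L p k (r : 'M[R]_(p, k)) (x y : 'I_k -> L) i :
  x =1 y -> mact r x i = mact r y i.
Proof. by move=> e; apply: eq_bigr => j _; rewrite e. Qed.

(** Flatness, as the equational criterion: every linear relation in [L] is a
    consequence of linear relations in the ring. *)
Definition flat L : Prop :=
  forall p k (r : 'M[R]_(p, k)) (x : 'I_k -> L), (forall i, mact r x i = 0) ->
    exists m (c : 'M[R]_(k, m)) (y : 'I_m -> L),
      (forall j, x j = mact c y j) /\ r *m c = 0.

Lemma flat_of_rows L :
  (forall k (r : 'rV[R]_k) (x : 'I_k -> L), mact r x 0 = 0 ->
    exists m (c : 'M[R]_(k, m)) (y : 'I_m -> L),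
      (forall j, x j = mact c y j) /\ r *m c = 0) -> flat L.
Proof.
move=> h1; elim=> [|p IH] k r x hx.
  exists k, 1%:M, x; split=> [j|]; last exact: flatmx0.
  rewrite /mact (bigD1 j) //= big1 => [|i ne].
    by rewrite !mxE eqxx scale1r addr0.
  by rewrite !mxE eq_sym (negbTE ne) scale0r.
have [|m [c [y [xE rc]]]] := h1 _ (row ord0 r) x.
  by rewrite -[RHS](hx ord0); apply: eq_bigr => j _; rewrite mxE.
have [i|m' [c' [y' [yE rc']]]] := IH _ (row' ord0 r *m c) y.
  rewrite mact_mul -[RHS](hx (fintype.lift ord0 i)) /mact.
  by apply: eq_bigr => j _; rewrite mxE xE.
exists m', (c *m c'), y'; split=> [j|].
  by rewrite xE mact_mul; apply: eq_mact.
apply/row_matrixP => i; rewrite row_mul row0 mulmxA.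
have [j|] := unliftP ord0 i => ->; last by rewrite rc mul0mx.
have : row j (row' ord0 r *m c *m c') = 0 by rewrite rc' row0.
by rewrite !row_mul -row_rowsub.
Qed.

Lemma free_flat_aux (F : lmodType R) (T : choiceType) (b : T -> F)
    (c : T -> {linear F -> R^o}) :
  (forall x, exists2 s : seq T, uniq s & forall s', uniq s' ->
     {subset s <= s'} -> x = \sum_(t <- s') (c t x : R) *: b t) ->
  forall k (x : 'I_k -> F), exists s : seq T, uniq s /\
    forall j, x j = \sum_(t <- s) (c t (x j) : R) *: b t.
Proof.
move=> ex k x.
have exj j : exists s, uniq s /\ forall s', uniq s' ->
    {subset s <= s'} -> x j = \sum_(t <- s') (c t (x j) : R) *: b t.
  by have [s us h] := ex (x j); exists s.
have [s sE] := choice exj.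
exists (undup (flatten [seq s j | j <- enum 'I_k])); split=> [|j].
  exact: undup_uniq.
have [_ h] := sE j; apply: h; first exact: undup_uniq.
move=> t tj; rewrite mem_undup; apply/flattenP; exists (s j) => //.
by apply: map_f; rewrite mem_enum.
Qed.

Lemma projective_flat P : projective P -> flat P.
Proof.
move=> hP p k r x rx.
have [F [b [c [Fp cb ex uni]]]] := free_projective_ex R P.
have [q qE] := uni P id.
have [s sE] := proj_lift (f := q) (g := idfun) hP
  (fun y => ex_intro _ (b y) (qE y)).
have [ts [_ hts]] := free_flat_aux ex (s \o x).
pose t0 : P := 0.
exists (size ts), (\matrix_(j, l) (c (nth t0 ts l) (s (x j)) : R)),
  (fun l => nth t0 ts l); split=> [j|].
  rewrite -[x j]/(idfun (x j)) -[LHS]sE [s _]hts linear_sum.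
  rewrite (big_nth t0) big_mkord.
  by apply: eq_bigr => l _; rewrite linearZ /= qE mxE.
apply/matrixP => i l; rewrite !mxE.
under eq_bigr do rewrite mxE.
transitivity (c (nth t0 ts l) (s (mact r x i))); last by rewrite rx !linear0.
by rewrite !linear_sum; apply: eq_bigr => j _; rewrite !linearZ.
Qed.

Section Lazard.
Variables (L F : lmodType R) (b : L * nat -> F)
  (c : L * nat -> {linear F -> R^o}) (q : {linear F -> L}).
Hypotheses (hL : flat L) (cb : forall t t', c t (b t') = (t == t')%:R)
  (ex : forall x, exists2 s : seq (L * nat), uniq s & forall s', uniq s' ->
     {subset s <= s'} -> x = \sum_(t <- s') (c t x : R) *: b t)
  (qE : forall t, q (b t) = t.1).

(** Finitely many relations involve finitely many basis elements [b (sn j)], and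
    by flatness the images of these in [L] are combinations of elements [y l],
    with a matrix [d] of coefficients that the matrix of the relations
    annihilates.  Taking new basis elements over the [y l], the differences
    [b (sn j) - \sum_l d j l *: b (fresh l)] are relations.  They are
    independent, since the new basis elements are distinct from the old ones,
    and their span contains the given relations. *)
Lemma fin_free_cover p (v : 'I_p -> F) : (forall i, q (v i) = 0) ->
  exists k (h : {linear 'rV[R]_k -> F}), [/\ injective h,
    forall u, q (h u) = 0 & forall i, exists u, h u = v i].
Proof.
move=> qv; have [s [us sE]] := free_flat_aux ex v.
pose t0 : L * nat := (0, 0%N); pose sn (j : 'I_(size s)) := nth t0 s j.
pose r := \matrix_(i < p, j < size s) (c (sn j) (v i) : R).
have vE i : v i = \sum_j r i j *: b (sn j).
  rewrite [LHS]sE (big_nth t0) big_mkord.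
  by apply: eq_bigr => j _; rewrite mxE.
have [i|m [d [y [xE rd]]]] := hL (r := r) (x := fun j => (sn j).1).
  rewrite -(qv i) [in RHS]vE linear_sum.
  by apply: eq_bigr => j _; rewrite linearZ /= qE.
pose N := (\max_(t <- s) t.2).+1.
(* [N] exceeds every index that occurs in [s]. *)
pose fresh (l : 'I_m) : L * nat := (y l, N).
have freshN l j : sn j != fresh l.
  apply/eqP => e; have : sn j \in s by apply: mem_nth.
  by rewrite e => /(@leq_bigmax_seq _ _ xpredT snd) /(_ isT); rewrite /= ltnn.
have [h hE] := rV_map (fun j => b (sn j) - \sum_l d j l *: b (fresh l)).
exists (size s), h; split.
- apply: injP => u hu; apply/rowP => j; rewrite [RHS]mxE.
  have := congr1 (c (sn j)) hu; rewrite linear0 hE linear_sum => <-.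
  rewrite (bigD1 j) //= [X in _ + X]big1 => [|i ne].
    rewrite addr0 linearZ linearB /= cb eqxx linear_sum big1 => [|l _].
      by rewrite subr0 /GRing.scale /= mulr1.
    by rewrite linearZ /= cb (negbTE (freshN _ _)) scaler0.
  rewrite linearZ linearB /= cb linear_sum big1 => [|l _].
    by rewrite nth_uniq // (inj_eq val_inj) eq_sym (negbTE ne) subr0 scaler0.
  by rewrite linearZ /= cb (negbTE (freshN _ _)) scaler0.
- move=> u; rewrite hE linear_sum big1 // => j _.
  rewrite linearZ linearB /= qE linear_sum xE.
  rewrite (_ : \sum_(i < m) _ = mact d y j) ?subrr ?scaler0 //.
  by apply: eq_bigr => l _; rewrite linearZ /= qE.
- move=> i; exists (row i r); rewrite hE.
  under eq_bigr do rewrite mxE scalerBr.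
  rewrite sumrB -vE (_ : \sum_(j < _) _ = 0) ?subr0 //.
  transitivity (mact (r *m d) (b \o fresh) i); first by rewrite mact_mul.
  by rewrite rd /mact big1 // => l _; rewrite mxE scale0r.
Qed.

Lemma relations_left_orth (CC : lmodType R -> Prop) : periodic_class CC ->
  left_orth CC (fun v => q v = 0).
Proof.
move=> hCC.
pose X := {classic {k : nat & {h : {linear 'rV[R]_k -> F} |
  injective h /\ forall u, q (h u) = 0}}}.
pose V (x : X) v := exists u, sval (projT2 x) u = v.
have cover p (v : 'I_p -> F) : (forall i, q (v i) = 0) ->
    exists x : X, forall i, V x (v i).
  move=> /fin_free_cover [k [h [hi hq hv]]].
  by exists (existT _ k (exist _ h (conj hi hq))).
have sV x : submod (V x) by apply: img_submod.
have contain (x z : X) : (forall i, V z (sval (projT2 x) (delta_mx 0 i))) ->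
    forall v, V x v -> V z v.
  move=> hz _ [u <-]; rewrite rV_expand; apply: submod_sum => // i.
  exact: submodZ (sV z) _ _ (hz i).
have -> : (fun v => q v = 0) = (fun v => exists x, V x v).
  apply/funext => v; apply/propext; split=> [qv|[x [u <-]]].
    have [x hx] := @cover 1 (fun=> v) (fun=> qv).
    by exists x; apply: (hx 0).
  by have [_ ->] := svalP (projT2 x).
have [x0 _] := @cover 0 (fun=> 0) (fun=> linear0 q).
apply: (directed_union_orth hCC x0) => // [x y|x].
  pose vx i := sval (projT2 x) (delta_mx 0 i).
  pose vy i := sval (projT2 y) (delta_mx 0 i).
  pose v i := match fintype.split i with inl j => vx j | inr j => vy j end.
  have [i|z hz] := cover _ v.
    rewrite /v; case: (fintype.split i) => j.
      by have [_ ->] := svalP (projT2 x).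
    by have [_ ->] := svalP (projT2 y).
  exists z; split; apply: contain => i.
    by have := hz (lshift _ i); rewrite /v (unsplitK (inl i)).
  by have := hz (rshift _ i); rewrite /v (unsplitK (inr i)).
apply: projective_left_orth; first exact: rV_projective.
by have [] := svalP (projT2 x).
Qed.

End Lazard.

(** Write [L] as a quotient of a free module.  By [fin_free_cover] the module of
    relations is a directed union of finite free submodules, hence orthogonal,
    and then so is the quotient.  The basis is [L * nat] so that each element of
    [L] is the image of infinitely many basis elements. *)
Lemma flat_orth (CC : lmodType R -> Prop) L T :
  periodic_class CC -> flat L -> CC T -> orth L T.
Proof.
move=> hCC hL hT.
have [F [b [c [Fp cb ex uni]]]] := free_projective_ex R (L * nat)%type.
have [q qE] := uni L fst.
have qs : surj q by move=> l; exists (b (l, 0%N)); rewrite qE.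
have [K [a S]] := ses_of_surj qs.
have [ai exa _] := S.
apply: (orth_class_quot hCC S) hT => T' hT'; last exact: orth_projective.
apply: left_orth_orth ai exa _ hT'.
have h := relations_left_orth hL cb ex qE hCC.
exact: h.
Qed.

End Flatness.

(** * Resolutions over coherent rings *)

Section Coherence.
Variable R : pzRingType.
Hypothesis cohR : left_coherent R.

(** Schanuel's argument: a finitely presented module, here the image of [f], has
    finitely generated relations with respect to any finite set of
    generators. *)
Lemma coherent_functional_kernel m (f : {linear 'rV[R]_m -> R^o}) :
  exists m' (d' : {linear 'rV[R]_m' -> 'rV[R]_m}), exact_at d' f.
Proof.
have [I [i [ii iE]]] := submodule_ex (img_submod f).
have [p pE] := factor_inj ii (fun x => (iE (f x)).1 (ex_intro _ x erefl)).
have ps : surj p.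
  move=> y; have [x xE] := (iE (i y)).2 (ex_intro _ y erefl).
  by exists x; apply: ii; rewrite pE.
have fgI : fin_gen I.
  exists m, (fun j => p (delta_mx 0 j)) => y; have [u <-] := ps y.
  by exists (u 0); exact: rV_expand.
have [a [b [al [g [exg gs]]]]] := cohR ii fgI.
have [be beE] := proj_lift (f := p) (g := g) (@rV_projective R b)
  (fun x => ps _).
have [ga gaE] := proj_lift (f := g) (g := p) (@rV_projective R m)
  (fun x => gs _).
have [co coE] := copair_maps (be \o al) (idfun \- (be \o ga)).
have [un unE] := pair_maps (@lsubmx R 1 a m : {linear _ -> _})
  (@rsubmx R 1 a m : {linear _ -> _}).
have fp x : f x = 0 <-> p x = 0.
  rewrite -pE; split=> [|->]; last by rewrite linear0.
  by rewrite -{1}(linear0 i) => /ii.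
exists (a + m)%N, (co \o un) => x; rewrite fp; split=> [px|[u <-]].
  have [y yE] : exists y, al y = ga x by apply/exg; rewrite gaE.
    exists (row_mx y x); rewrite /= unE coE /= row_mxKl row_mxKr yE.
    by rewrite addrC subrK.
rewrite /= unE coE /= linearD linearB !beE gaE subrr addr0.
by apply/exg; exists (lsubmx u).
Qed.

Lemma coherent_common_kernel k m (f : 'I_k -> {linear 'rV[R]_m -> R^o}) :
  exists m' (d' : {linear 'rV[R]_m' -> 'rV[R]_m}),
    forall x, (forall i, f i x = 0) <-> exists y, d' y = x.
Proof.
elim: k f => [|k IH] f.
  by exists m, idfun => x; split=> [_|_ []//]; exists x.
have [m1 [d1 h1]] := IH (fun i => f (fintype.lift ord0 i)).
have [m2 [d2 h2]] := coherent_functional_kernel (f ord0 \o d1).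
exists m2, (d1 \o d2) => x; split=> [fx|[y <-] i].
  have [y yE] := (h1 x).1 (fun i => fx _).
  have [z zE] : exists z, d2 z = y by apply/h2; rewrite /= yE.
  by exists z; rewrite /= zE.
have [j|] := unliftP ord0 i => ->.
  exact: (h1 _).2 (ex_intro _ (d2 y) erefl) j.
by apply/h2; exists y.
Qed.

Lemma coherent_kernel k m (d : {linear 'rV[R]_m -> 'rV[R]_k}) :
  exists m' (d' : {linear 'rV[R]_m' -> 'rV[R]_m}), exact_at d' d.
Proof.
have fE i : exists f : {linear 'rV[R]_m -> R^o}, forall x, f x = d x 0 i.
  by apply: linear_ex => a x y; rewrite linearP !mxE.
have [f hf] := choice fE.
have [m' [d' h]] := coherent_common_kernel f.
exists m', d' => x; rewrite -h; split=> [dx i|fx]; first by rewrite hf dx mxE.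
by apply/rowP => i; rewrite -hf fx mxE.
Qed.

(** The first two terms are fixed definitionally, so that the first differential
    can be prescribed. *)
Definition resolution_mod k m (Q : nat -> lmodType R) (i : nat) : lmodType R :=
  match i with 0%N => 'rV[R]_k | 1%N => 'rV[R]_m | j.+2 => Q j end.

Lemma coherent_resolution k m (d : {linear 'rV[R]_m -> 'rV[R]_k}) :
  exists (F : lmodType R) (Q : nat -> lmodType R)
    (dd : forall i,
       {linear resolution_mod k m Q i.+1 -> resolution_mod k m Q i})
    (e : {linear resolution_mod k m Q 0 -> F}),
    [/\ dd 0%N = d, projective_resolution dd e
      & forall i, fin_gen (resolution_mod k m Q i)].
Proof.
pose St := {a : nat & {b : nat & {linear 'rV[R]_a -> 'rV[R]_b}}}.
pose dom (s : St) := projT1 s; pose cod (s : St) := projT1 (projT2 s).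
pose map (s : St) : {linear 'rV[R]_(dom s) -> 'rV[R]_(cod s)} :=
  projT2 (projT2 s).
pose ker (s : St) := cid (coherent_kernel (map s)).
pose nx (s : St) : St :=
  existT _ (sval (ker s)) (existT _ (dom s) (sval (cid (svalP (ker s))))).
have nxE s : exact_at (map (nx s)) (map s) := svalP (cid (svalP (ker s))).
pose t i := iter i nx (existT _ m (existT _ k d) : St).
have [F [e [es eE]]] := quotient_ex (img_submod d).
pose Q j : lmodType R := 'rV[R]_(cod (t j.+2)).
pose dd i : {linear resolution_mod k m Q i.+1 -> resolution_mod k m Q i} :=
  match i with
  | 0%N => map (t 0%N) | 1%N => map (t 1%N) | j.+2 => map (t j.+2) end.
exists F, Q, dd, e; split=> //.
- split; last by case=> [|[|i]]; apply: rV_projective.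
  split=> //; first by case=> [|[|i]]; apply: nxE.
- by case=> [|[|i]]; apply: rV_fin_gen.
Qed.

Lemma coherent_FP_infty k m (d : {linear 'rV[R]_m -> 'rV[R]_k}) :
  exists (F : lmodType R) (Q : nat -> lmodType R)
    (dd : forall i,
       {linear resolution_mod k m Q i.+1 -> resolution_mod k m Q i})
    (e : {linear resolution_mod k m Q 0 -> F}),
    [/\ FP_infty F, dd 0%N = d & projective_resolution dd e].
Proof.
have [F [Q [dd [e [dd0 res fg]]]]] := coherent_resolution d.
by exists F, Q, dd, e; split=> //; exists (resolution_mod k m Q), dd, e.
Qed.

End Coherence.

(** * Pure submodules of modules of finite projective dimension *)

Section Purity.
Variable R : pzRingType.
Implicit Types A B M T K F L P Q KA KB : lmodType R.

(** Purity in terms of finite systems of linear equations. *)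
Definition pure A B (a : {linear A -> B}) : Prop :=
  forall p k (r : 'M[R]_(p, k)) (x : 'I_p -> A) (y : 'I_k -> B),
    (forall i, mact r y i = a (x i)) ->
    exists z : 'I_k -> A, forall i, mact r z i = x i.

(** The equations define a map from the finite free module [P 1] to [A]; it is a
    cocycle since it is a coboundary in [B], and an extension to [P 0] is a
    solution in [A]. *)
Lemma absolutely_clean_pure A B (a : {linear A -> B}) :
  left_coherent R -> absolutely_clean A -> injective a -> pure a.
Proof.
move=> coh hA ai p k r x y ry.
have [|d dE] := @linear_ex R 'rV[R]_p 'rV[R]_k (fun u => u *m r).
  by move=> t u v; rewrite mulmxDl scalemxAl.
have [F [Q [dd [e [hF dd0 res]]]]] := coherent_FP_infty coh d.
have [g gE] := rV_map x.
have gd := rV_delta gE.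
have ag u : a (g u) = mact (u *m r) y 0.
  rewrite gE mact_mul linear_sum; apply: eq_bigr => i _.
  by rewrite linearZ ry.
have [u|l lE] := (hA F hF _ dd e res g).1.
  apply: ai; rewrite ag linear0 -dE -dd0.
  rewrite (_ : dd 0%N _ = 0); last first.
    by have [[ex _ _] _] := res; apply/ex; exists u.
  by rewrite /mact big1 // => j _; rewrite mxE scale0r.
exists (fun j => l (delta_mx 0 j)) => i.
rewrite -[RHS]gd -[g _]lE /= dd0 dE -rowE [RHS]rV_expand.
by apply: eq_bigr => j _; rewrite mxE.
Qed.

Lemma pure_in_projective_flat A P (a : {linear A -> P}) :
  injective a -> pure a -> projective P -> flat A.
Proof.
move=> ai hpure hP p k r x rx.
have [i|m [c [y [xE rc]]]] := projective_flat hP (r := r) (x := a \o x).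
  by rewrite -mact_linear rx linear0.
have [z zE] := hpure _ _ c x y (fun j => esym (xE j)).
by exists m, c, z; split=> // j; rewrite zE.
Qed.

(** The components in [Q] of a solution of a system form a solution of the
    homogeneous system in a projective, hence flat, module. They are therefore
    parametrized, and by purity of [a] the parameters can be replaced by
    elements of [P], which turns the components in [P] into a solution in
    [KA]. *)
Lemma pure_syzygy A B P Q KA KB (a : {linear A -> B})
    (i : {linear KA -> P}) (pA : {linear P -> A}) (pB : {linear Q -> B})
    (q : {linear (P * Q)%type -> B}) (j : {linear KB -> (P * Q)%type})
    (a' : {linear KA -> KB}) :
  injective a -> pure a -> projective Q -> ses i pA ->
  (forall x y, q (x, y) = a (pA x) + pB y) -> ses j q ->
  (forall x, j (a' x) = (i x, 0)) -> pure a'.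
Proof.
move=> ai hpure hQ Si qE Sj a'E p k r x y ry.
have [ii _ ps] := Si.
pose v1 l := (j (y l)).1; pose v2 l := (j (y l)).2.
have rj l : mact r (fun l => j (y l)) l = (i (x l), 0).
  by rewrite -a'E -ry mact_linear.
have r1 l : mact r v1 l = i (x l).
  by have /(congr1 fst) /= <- := rj l; rewrite linear_sum.
have r2 l : mact r v2 l = 0.
  by have /(congr1 snd) /= <- := rj l; rewrite linear_sum.
have [m [c [w [v2E rc]]]] := projective_flat hQ r2.
have [l|z zE] := hpure _ _ c (fun l => - pA (v1 l)) (pB \o w).
  rewrite -mact_linear -v2E linearN; apply/eqP; rewrite -addr_eq0 addrC -qE.
  by rewrite /v1 /v2 -surjective_pairing (ses_comp Sj).
have [t tE] := choice (fun l => ps (z l)).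
have lift_s l : exists s, i s = v1 l + mact c t l.
  apply: (ses_ker Si); rewrite linearD mact_linear.
  rewrite (@eq_mact _ _ _ _ c _ z); last by move=> u; apply: tE.
  by rewrite zE subrr.
have [s sE] := choice lift_s.
exists s => l; apply: ii; rewrite mact_linear -r1.
rewrite (@eq_mact _ _ _ _ r _ (fun u => v1 u + mact c t u)) //.
transitivity (mact r v1 l + mact r (mact c t) l).
  by rewrite -big_split; apply: eq_bigr => u _; rewrite /= scalerDr.
rewrite -mact_mul rc [X in _ + X]big1 ?addr0 // => u _.
by rewrite mxE scale0r.
Qed.

(** Descending along syzygies of [B], which keep a pure submodule by
    [pure_syzygy], ends with a pure submodule of a projective module, and such a
    module is flat. *)
Lemma pure_orth (CC : lmodType R -> Prop) n A B (a : {linear A -> B}) T :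
  periodic_class CC -> injective a -> pure a -> pd_le n B -> CC T -> orth A T.
Proof.
move=> hCC; elim: n A B a T => [|n IH] A B a T ai hpure hB hT.
  exact: flat_orth hCC (pure_in_projective_flat ai hpure hB) hT.
have [KA [P [i [pA [hP Si]]]]] := ses_projective A.
have [KB' [Q [i' [pB [hQ Si']]]]] := ses_projective B.
have [q qE] := copair_maps (a \o pA) pB.
have qs : surj q.
  have [_ _ pBs] := Si' => b; have [y <-] := pBs b.
  by exists (0, y); rewrite qE linear0 add0r.
have [KB [j Sj]] := ses_of_surj qs.
have [inl inlE] := pair_maps (idfun : {linear P -> P}) (\0 : {linear P -> Q}).
have [x|a' a'E] := ses_lift Sj (h := inl \o i).
  by rewrite /= inlE qE /= (ses_comp Si) !linear0 addr0.
have {}a'E x : j (a' x) = (i x, 0) by rewrite a'E /= inlE.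
have a'i : injective a'.
  have [ii _ _] := Si => x y /(congr1 j); rewrite !a'E => -[].
  exact: ii.
have a'pure := pure_syzygy ai hpure hQ Si qE Sj a'E.
apply: (orth_class_quot hCC Si) hT => T' hT'; last exact: orth_projective.
exact: IH a'i a'pure (hB _ _ _ _ (pair_projective hP hQ) Sj) hT'.
Qed.

End Purity.

(** * Level modules over right coherent rings *)

Section Level.
Variable R : pzRingType.

Lemma tens0l (P : lmodType R^c) (L : lmodType R) (l : L) : tens (0 : P) l = 0.
Proof. by apply: (@addrI _ (tens 0 l)); rewrite -tensDl !addr0. Qed.

Lemma tens0r (P : lmodType R^c) (L : lmodType R) (p : P) : tens p (0 : L) = 0.
Proof. by apply: (@addrI _ (tens p 0)); rewrite -tensDr !addr0. Qed.

Lemma tens_sumr (P : lmodType R^c) (L : lmodType R) (p : P) (I : Type)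
    (r : seq I) (F : I -> L) :
  tens p (\sum_(i <- r) F i) = \sum_(i <- r) tens p (F i).
Proof. exact: (big_morph _ (tensDr p) (tens0r _ p)). Qed.

Lemma tensor_map_sum (P Q : lmodType R^c) (f : {linear P -> Q})
    (L : lmodType R) (I : Type) (s : seq I) (G : I -> tensor P L) :
  tensor_map f (\sum_(i <- s) G i) = \sum_(i <- s) tensor_map f (G i).
Proof.
apply: (big_morph _ (@tensor_mapD R P Q f L)).
by apply: (@addrI _ (tensor_map f 0)); rewrite -tensor_mapD !addr0.
Qed.

Lemma tensor_gen (P : lmodType R^c) (L : lmodType R) (s : tensor P L) :
  exists ps : seq (P * L), s = \sum_(z <- ps) tens z.1 z.2.
Proof.
pose G (s : tensor P L) :=
  exists ps : seq (P * L), s = \sum_(z <- ps) tens z.1 z.2.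
have G0 : G 0 by exists [::]; rewrite big_nil.
have GD u v : G u -> G v -> G (u + v).
  by move=> [ps ->] [ps' ->]; exists (ps ++ ps'); rewrite big_cat.
have GN u : G u -> G (- u).
  move=> [ps ->]; exists [seq (- z.1, z.2) | z <- ps].
  rewrite big_map -sumrN; apply: eq_bigr => z _ /=; apply/esym/eqP.
  by rewrite -addr_eq0 -tensDl addNr tens0l.
have Gtens p l : G (tens p l) by exists [:: (p, l)]; rewrite big_seq1.
have GMz u (k : int) : G u -> G (u *~ k).
  move=> Gu; have Gn n : G (u *+ n).
    by elim: n => [|n IH] //; rewrite mulrS; apply: GD.
  by case: k => n; [apply: Gn | rewrite NegzE mulrNz; apply/GN/Gn].
suff : G s by [].
rewrite -[s]reprK -(freeg_sumE (repr s)).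
have piD (x y : {freeg (P * L) / int}) :
    \pi_(tensor P L) (x + y) =
    \pi_(tensor P L) x + \pi_(tensor P L) y :> tensor P L.
  exact: raddfD.
have pi0 : \pi_(tensor P L) 0 = 0 :> tensor P L by exact: raddf0.
rewrite (big_morph _ piD pi0).
elim/big_ind: _ => // z _.
rewrite (_ : << coeff z (repr s) *g z >> = << z >> *~ coeff z (repr s)).
  have -> : \pi_(tensor P L) (<< z >> *~ coeff z (repr s)) =
    (tens z.1 z.2) *~ coeff z (repr s) :> tensor P L.
    rewrite /tens -surjective_pairing; exact: raddfMz.
  exact: GMz.
by rewrite freegU_mulz intz.
Qed.

(** The coordinates identify the tensor product of a free module of rank [k]
    with [k] copies of [L]. *)
Lemma coord_tensor k (L : lmodType R) :
  exists co : 'I_k -> tensor 'rV[R^c]_k L -> L,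
    (forall j p l, co j (tens p l) = (p 0 j : R) *: l) /\
    (forall j (I : Type) (s : seq I) (G : I -> tensor 'rV[R^c]_k L),
       co j (\sum_(i <- s) G i) = \sum_(i <- s) co j (G i)).
Proof.
pose co j := tensor_lift (fun (p : 'rV[R^c]_k) (l : L) => (p 0 j : R) *: l).
have bDl j (p p' : 'rV[R^c]_k) (l : L) :
    ((p + p') 0 j : R) *: l = (p 0 j : R) *: l + (p' 0 j : R) *: l.
  by rewrite mxE scalerDl.
have bDr j (p : 'rV[R^c]_k) (l l' : L) :
    (p 0 j : R) *: (l + l') = (p 0 j : R) *: l + (p 0 j : R) *: l'.
  by rewrite scalerDr.
have bZ j (r : R) (p : 'rV[R^c]_k) (l : L) :
    (((r : R^c) *: p) 0 j : R) *: l = (p 0 j : R) *: (r *: l).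
  by rewrite mxE scalerA.
have coD j : {morph co j : s t / s + t}.
  exact: tensor_liftD (bDl j) (bDr j) (bZ j).
exists co; split=> [j p l|j I s G].
  exact: (tensor_lift_tens (bDl j) (bDr j) (bZ j)).
apply: (big_morph _ (coD j)).
by apply: (@addrI _ (co j 0)); rewrite -coD !addr0.
Qed.

(** For one equation [\sum_j r_j x_j = 0], resolve the cyclic right module
    presented by the row [r].  The element [\sum_j e_j (x) x_j] is a cycle, and
    in coordinates a chain of which it is the boundary expresses [x] by elements
    [y] with coefficients in the kernel of [r]. *)
Lemma level_flat (L : lmodType R) : right_coherent R -> level L -> flat L.
Proof.
move=> coh hL; apply: flat_of_rows => k r x rx.
have [|d dE] := @linear_ex R^c 'rV[R^c]_k 'rV[R^c]_1
    (fun u => \row__ \sum_j r 0 j * (u 0 j : R)).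
  move=> t u v; apply/rowP => i; rewrite !mxE.
  transitivity ((\sum_j r 0 j * (u 0 j : R)) * (t : R) +
    \sum_j r 0 j * (v 0 j : R) : R); last by [].
  rewrite mulr_suml -big_split; apply: eq_bigr => j _; rewrite !mxE.
  rewrite -[LHS]/(r 0 j * ((u 0 j : R) * (t : R) + (v 0 j : R)) : R).
  by rewrite mulrDr mulrA.
have [F [Q [dd [e [hF dd0 res]]]]] := coherent_FP_infty coh d.
have Tor := hL F hF _ dd e res.
pose t : tensor 'rV[R^c]_k L := \sum_j tens (delta_mx 0 j) (x j).
have dt : tensor_map (dd 0%N) (t : tensor (resolution_mod 1 k Q 1) L) = 0.
  rewrite tensor_map_sum dd0.
  under eq_bigr do rewrite tensor_map_tens.
  pose e1 : 'rV[R^c]_1 := const_mx 1.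
  have de j : d (delta_mx 0 j) = (r 0 j : R^c) *: e1.
    apply/rowP => i; rewrite dE !mxE (bigD1 j) //= big1 => [|l ne].
      by rewrite mxE !eqxx addr0 !mulr1.
    by rewrite mxE (negbTE ne) andbF mulr0.
  under eq_bigr do rewrite de tensZ.
  by rewrite -tens_sumr (_ : \sum_j _ = 0) ?tens0r.
have [s sE] := (Tor t).1 dt.
have [ps psE] := tensor_gen s.
have [co coE] := coord_tensor k L.
have xE j : x j = \sum_(z <- ps) (dd 1%N z.1 0 j : R) *: z.2.
  transitivity (co j t).
    rewrite coE.2 (bigD1 j) //= coE.1 big1 => [|l ne].
      by rewrite mxE !eqxx addr0 scale1r.
    by rewrite coE.1 mxE eq_sym (negbTE ne) andbF scale0r.
  rewrite -sE psE tensor_map_sum coE.2; apply: eq_bigr => z _.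
  by rewrite tensor_map_tens coE.1.
pose z0 : resolution_mod 1 k Q 2 * L := (0, 0).
exists (size ps), (\matrix_(j, l) (dd 1%N (nth z0 ps l).1 0 j : R)),
  (fun l => (nth z0 ps l).2); split=> [j|].
  rewrite xE (big_nth z0) big_mkord; apply: eq_bigr => l _.
  by rewrite mxE.
apply/matrixP => i l; rewrite !mxE ord1.
under eq_bigr do rewrite mxE.
have [[ex _ _] _] := res.
have : d (dd 1%N (nth z0 ps l).1) = 0.
  by rewrite -dd0; exact: (ex 0%N _).2 (ex_intro _ (nth z0 ps l).1 erefl).
by move/rowP => /(_ 0); rewrite dE !mxE.
Qed.

End Level.

(** * Rings of finite Gorenstein global dimension *)

Section Main.
Variable R : pzRingType.
Implicit Types M A L P I : lmodType R.

Lemma pd_le_orth (CC : lmodType R -> Prop) n L T :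
  periodic_class CC -> pd_le n L -> CC T -> orth L T.
Proof.
move=> hCC; elim: n L T => [|n IH] L T.
  by move=> hL _; apply: orth_projective.
move=> hL hT; have [K [P [a [b [hP S]]]]] := ses_projective L.
apply: (orth_class_quot hCC S) hT => T' hT'; last exact: orth_projective.
exact: IH (hL _ _ _ _ hP S) hT'.
Qed.

Lemma cosyz_orth (CC : lmodType R -> Prop) n L C T :
  periodic_class CC ->
  (forall I T, injective_module I -> CC T -> orth I T) ->
  (forall T, CC T -> orth L T) -> cosyz n L C -> CC T -> orth C T.
Proof.
move=> hCC injCC oL; elim: n C T => [|n IH] C T /=.
  by move=> -> ; apply: oL.
move=> [C1 [I [i [p [h hI S]]]]]; apply: (orth_class_quot hCC S) => T' hT'.
  exact: IH h hT'.
exact: injCC.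
Qed.

Section FiniteGorenstein.
Variable n : nat.
Hypothesis hR : forall M, Gpd_le n M.

Lemma projective_cosyz_injective P P' :
  projective P -> cosyz n P P' -> injective_module P'.
Proof. by move=> /tot_test_projective; apply: (tot_test_id hR). Qed.

Lemma cosyz_periodic : periodic_class (@cosyz_class R n).
Proof. exact: cosyz_class_periodic projective_cosyz_injective. Qed.

Lemma injective_cosyz_orth I T :
  injective_module I -> cosyz_class n T -> orth I T.
Proof.
move=> /tot_test_injective /(tot_test_pd hR) hI.
exact: pd_le_orth cosyz_periodic hI.
Qed.

Lemma tot_test_of_injective_cosyz m L C :
  cosyz m L C -> injective_module C -> tot_test L.
Proof.
elim: m L => [|m IH] L; first by move=> /= -> /tot_test_injective.
move=> /cosyz_first [L1 [I [i [p [hI S h]]]]] hC.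
exact: tot_test_sub S (tot_test_injective hI) (IH _ h hC).
Qed.

(** The n-th cosyzygy [C] of a flat module [L] is orthogonal to the class of
    n-th cosyzygies, along with [L] and the injectives; hence the sequence
    that presents [C] as a quotient of an injective splits, and [L] has finite
    injective dimension. *)
Lemma flat_tot_test L : flat L -> tot_test L.
Proof.
move=> hL; have [C hC] := cosyz_ex n L.
apply: (tot_test_of_injective_cosyz hC).
have CCC : cosyz_class n C by exists L.
have [C1 [I [i [p [hC1 hI S]]]]] := cosyz_periodic.1 C CCC.
have oC : orth C C1.
  apply: (cosyz_orth cosyz_periodic injective_cosyz_orth _ hC hC1) => T hT.
  exact: flat_orth cosyz_periodic hL hT.
have [s sE] := oC _ _ _ _ hI S idfun.
exact: injective_retract hI sE.
Qed.

(** Embed [A] in an injective module, which has finite projective dimension. *)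
Lemma absolutely_clean_cosyz_orth A T :
  left_coherent R -> absolutely_clean A -> cosyz_class n T -> orth A T.
Proof.
move=> coh hA; have [I [i [hI ii]]] := enough_injectives A.
have hpure := absolutely_clean_pure coh hA ii.
have pdI := tot_test_pd hR (tot_test_injective hI).
exact: pure_orth cosyz_periodic ii hpure pdI.
Qed.

End FiniteGorenstein.
End Main.

Theorem theorem1p3 (R : pzRingType) (hR : Ggldim_finite R) :
  (right_coherent R -> GPac_gldim_finite R) /\
  (left_coherent R -> GIac_gldim_finite R).
Proof.
have [n hn] := hR; split=> coh; exists n => M.
  have [G [d [e [res GP G0]]]] := hn M.
  exists G, d, e; split=> // i le.
  have [X [dX [Xp ex cok hom]]] := GP i le.
  exists X, dX; split=> // L hL.
  by apply: (flat_tot_test hn (level_flat coh hL)); split.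
have [C hC] := cosyz_ex n M.
apply: (cosyz_coresolution _ _ hC).
  exact: injective_Gorenstein_AC_injective.
have hP := cosyz_periodic hn.
apply: (periodic_Gorenstein_AC_injective hP); last by exists M.
by move=> A C'; apply: absolutely_clean_cosyz_orth.
Qed.
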